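(* Let $w,\tau,v\in I_{d,n}$ with $w\ge\tau\ge v$. Then $$\mathrm{mult}_\tau X_w^v=(\mathrm{mult}_\tau X_w)\cdot(\mathrm{mult}_\tau X^v),$$ where $\mathrm{mult}_\tau$ denotes the multiplicity at the point $e_\tau$.
   Context: $K$ is an algebraically closed field of arbitrary characteristic, $1\le d<n$, and $G_{d,n}$ is the Grassmannian of $d$-dimensional subspaces of $K^n$. $I_{d,n}=\{(i_1,\dots,i_d)\in\mathbb{N}^d: 1\le i_1<\dots<i_d\le n\}$, partially ordered by $\underline i\ge\underline j\iff i_t\ge j_t$ for all $t$. For $\tau\in I_{d,n}$, $e_\tau\in G_{d,n}$ is the span of $e_{\tau_1},\dots,e_{\tau_d}$. With $V_t=\langle e_1,\dots,e_t\rangle$ and $V^t=\langle e_n,\dots,e_{n-t+1}\rangle$, the Schubert variety is $X_{\underline i}=\{U: \dim(U\cap V_{i_t})\ge t,\ 1\le t\le d\}$, the opposite Schubert variety is $X^{\underline i}=\{U:\dim(U\cap V^{n-i_{(d-t+1)}+1})\ge t,\ 1\le t\le d\}$, and the Richardson variety is $X_w^v=X_w\cap X^v$; it is nonempty iff $w\ge v$, and then reduced and irreducible. One has $e_\tau\in X_w^v\iff w\ge\tau\ge v$. Multiplicity: for a point $P$ on a variety $X$ with local ring $(A,\mathfrak m)$, $\mathrm{mult}_P(X)$ is the degree of $\mathrm{Proj}(\mathrm{gr}(A,\mathfrak m))$, where if the Hilbert polynomial of a standard graded $K$-algebra has degree $r$ and leading coefficient $c/r!$, its degree is $c$. (When $\dim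 X=0$ the multiplicity of a reduced point is $1$.) *)

(* Defs.v *)
From HB Require Import structures.
From mathcomp Require Import all_boot all_order all_algebra.
From mathcomp Require Import boolp classical_sets functions.
From mathcomp Require Import mpoly.

Set Implicit Arguments.
Unset Strict Implicit.
Unset Printing Implicit Defensive.

Import GRing.Theory.
Local Open Scope ring_scope.
Local Open Scope quotient_scope.

(* Multiplicity of a local K-algebra A, given with its structure map          *)
(* iota : K -> A.  The k-th graded piece of gr(A, m) is m^k / m^(k+1).        *)

Section Multiplicity.
Variables (K : fieldType) (A : comPzRingType) (iota : {rmorphism K -> A}).

(* The maximal ideal of a local ring is its set of non-units. *)
Definition max_ideal : set A := [set x | ~ exists y, x * y = 1].

Definition ideal_mul (I J : set A) : set A :=
  [set x | exists2 s : seq (A * A),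
     (forall p, p \in s -> I p.1 /\ J p.2) & x = \sum_(p <- s) p.1 * p.2].

Definition ideal_pow (I : set A) (k : nat) : set A := iter k (ideal_mul I) setT.

(* For K-subspaces W of V in A: the classes of b_0, ..., b_(r-1) form a basis *)
(* of V / W, so that V / W has dimension r.                                   *)
Definition quot_dim (V W : set A) (r : nat) : Prop :=
  exists2 b : 'I_r -> A, (forall i, V (b i)) &
    forall x, V x -> exists! c : 'rV[K]_r, W (x - \sum_i iota (c 0 i) * b i).

Definition is_hilbert_fun (h : nat -> nat) : Prop :=
  forall k, quot_dim (ideal_pow max_ideal k) (ideal_pow max_ideal k.+1) (h k).

Definition is_hilbert_poly (p : {poly rat}) : Prop :=
  exists2 h, is_hilbert_fun h &
    exists N, forall k, (N <= k)%N -> p.[k%:R] = (h k)%:R.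

(* If the Hilbert polynomial has degree r and leading coefficient c / r!, the *)
(* degree is c.  The Hilbert polynomial is 0 exactly in dimension 0, where    *)
(* the degree is set to 1: the local rings considered below are reduced.      *)
Definition hilbert_degree (p : {poly rat}) : rat :=
  if p == 0 then 1 else ((size p).-1)`!%:R * lead_coef p.

(* The default value 0 is never used for a Noetherian local ring with residue *)
(* field K, for which a unique Hilbert polynomial exists.                     *)
Definition multiplicity : rat :=
  xget 0 [set c | exists2 p, is_hilbert_poly p & c = hilbert_degree p].

End Multiplicity.

(* I_{d,n}.  The basis e_1, ..., e_n of K^n is indexed from 0 by 'I_n; the    *)
(* entries i_t, as in the usual notation, are recovered by [entry].           *)
Definition idx (d n : nat) : Type :=
  {i : d.-tuple 'I_n | sorted (fun a b : 'I_n => (a < b)%N) i}.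
HB.instance Definition _ d n := Finite.copy (idx d n)
  {i : d.-tuple 'I_n | sorted (fun a b : 'I_n => (a < b)%N) i}.

Section Grassmannian.
Variables (K : fieldType) (d n : nat).

Definition pos (i : idx d n) (t : 'I_d) : 'I_n := tnth (val i) t.
Definition entry (i : idx d n) (t : 'I_d) : nat := (pos i t).+1.

Definition idx_le (i j : idx d n) : bool :=
  [forall t : 'I_d, (entry i t <= entry j t)%N].

Lemma pos_inj (i : idx d n) : injective (pos i).
Proof.
have i_uniq : uniq (val i).
  apply: (sorted_uniq (leT := fun a b : 'I_n => (a < b)%N)) (valP i).
    by move=> a b c; apply: ltn_trans.
  by move=> a; rewrite /= ltnn.
by apply/tuple_uniqP.
Qed.

Definition std (j : 'I_n) : 'rV[K]_n := delta_mx 0 j.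

Definition grass : Type := {U : {vspace 'rV[K]_n} | \dim U == d}.

Definition coord_space (i : idx d n) : {vspace 'rV[K]_n} :=
  <<[tuple std (pos i t) | t < d]>>%VS.

Lemma coord_space_dim i : \dim (coord_space i) == d.
Proof.
suff /eqP -> : free [tuple std (pos i t) | t < d] by rewrite size_tuple.
apply/freeP => c c0 t.
have nthE (s : 'I_d) : [tuple std (pos i t) | t < d]`_s = std (pos i s).
  by rewrite -tnth_nth tnth_mktuple.
move/rowP/(_ (pos i t)): c0; rewrite summxE !mxE (bigD1 t) //= big1 => [|s st].
  by rewrite nthE !mxE !eqxx mulr1 addr0.
rewrite nthE !mxE eqxx /= (inj_eq (@pos_inj i)) eq_sym.
by rewrite (negPf st) mulr0.
Qed.

(* The point e_i of the Grassmannian. *)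
Definition coord_pt (i : idx d n) : grass := Sub (coord_space i) (coord_space_dim i).

(* V_t = <e_1, ..., e_t> and V^t = <e_n, ..., e_(n-t+1)>. *)
Definition flag (t : nat) : {vspace 'rV[K]_n} :=
  <<[seq std j | j : 'I_n <- enum 'I_n & (j.+1 <= t)%N]>>%VS.
Definition opp_flag (t : nat) : {vspace 'rV[K]_n} :=
  <<[seq std j | j : 'I_n <- enum 'I_n & (n - t + 1 <= j.+1)%N]>>%VS.

(* In both conditions t : 'I_d stands for the index t.+1 of 1, ..., d; thus   *)
(* rev_ord t stands for d - t.+1 + 1.                                         *)
Definition schubert (i : idx d n) : {pred grass} :=
  [pred U : grass |
    [forall t : 'I_d, (t.+1 <= \dim (val U :&: flag (entry i t)))%N]].
Definition opp_schubert (i : idx d n) : {pred grass} :=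
  [pred U : grass | [forall t : 'I_d,
    (t.+1 <= \dim (val U :&: opp_flag (n - entry i (rev_ord t) + 1)))%N]].
Definition richardson (w v : idx d n) : {pred grass} :=
  [predI schubert w & opp_schubert v].

(* Homogeneous coordinates of U in the Pluecker embedding, computed in one    *)
(* fixed basis of U; another basis rescales all of them by one unit.          *)
Definition plucker (U : grass) (i : idx d n) : K :=
  \det (\matrix_(a < d, b < d) (vbasis (val U))`_a 0 (pos i b)).

Definition peval (f : {mpoly K[#|{: idx d n}|]}) (U : grass) : K :=
  f.@[fun k => plucker U (enum_val k)].

(* S contains a Zariski neighbourhood of P: the nonvanishing loci of          *)
(* homogeneous polynomials form a base of the Zariski topology.               *)
Definition znear (P : grass) (S : set grass) : Prop :=
  exists e (h : {mpoly K[#|{: idx d n}|]}),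
    [/\ h \is e.-homog, peval h P != 0 & forall U, peval h U != 0 -> S U].

(* f is regular at P, as a function on X: in a neighbourhood of P in X it is  *)
(* a quotient of homogeneous polynomials of the same degree.                  *)
Definition regular_at (X : {pred grass}) (P : grass) (f : grass -> K) : Prop :=
  exists e (g h : {mpoly K[#|{: idx d n}|]}),
    [/\ g \is e.-homog, h \is e.-homog &
        znear P [set U | U \in X -> peval h U != 0 /\ f U = peval g U / peval h U]].

Lemma peval1 U : peval 1 U = 1. Proof. exact: meval1. Qed.
Lemma pevalM f g U : peval (f * g) U = peval f U * peval g U.
Proof. exact: mevalM. Qed.
Lemma pevalB f g U : peval (f - g) U = peval f U - peval g U.
Proof. exact: mevalB. Qed.
Lemma pevalC c U : peval c%:MP U = c. Proof. exact: mevalC. Qed.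

Lemma znearT P (S : set grass) : (forall U, S U) -> znear P S.
Proof.
move=> ST; exists 0%N, 1; split=> [||U _]; [exact: dhomog1| |exact: ST].
by rewrite peval1 oner_eq0.
Qed.

Lemma znearI P (S T Q : set grass) : (forall U, S U -> T U -> Q U) ->
  znear P S -> znear P T -> znear P Q.
Proof.
move=> STQ [e [h [hh hP hS]]] [e' [h' [hh' hP' hT]]].
exists (e + e')%N, (h * h'); split=> [||U]; first exact: dhomogM.
  by rewrite pevalM mulf_neq0.
by rewrite pevalM mulf_eq0 negb_or => /andP[/hS SU /hT TU]; apply: STQ.
Qed.

Section LocalRing.
Variables (X : {pred grass}) (P : grass).

Definition reg_pred : {pred (grass -> K)} := fun f => `[< regular_at X P f >].

Lemma reg_cst c : cst c \in reg_pred.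
Proof.
apply/asboolP; exists 0%N, c%:MP, 1; split; last 1 first.
- by apply: znearT => U _; rewrite peval1 pevalC divr1 oner_eq0.
- by rewrite -[c%:MP]mulr1 mul_mpolyC rpredZ // dhomog1.
- exact: dhomog1.
Qed.

Lemma reg_subring : subring_closed reg_pred.
Proof.
split=> [|f f'|f f']; first exact: reg_cst.
- move=> /asboolP[e [g [h [hg hh nf]]]] /asboolP[e' [g' [h' [hg' hh' nf']]]].
  apply/asboolP; exists (e + e')%N, (g * h' - g' * h), (h * h'); split.
  + by apply: rpredB; [|rewrite addnC]; exact: dhomogM.
  + exact: dhomogM.
  apply: znearI nf nf' => U SU TU XU; have [hU fU] := SU XU.
  have [hU' fU'] := TU XU; rewrite !(pevalM, pevalB) mulf_neq0 //; split=> //.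
  by rewrite !fctE fU fU' -mulNr addf_div // mulNr.
- move=> /asboolP[e [g [h [hg hh nf]]]] /asboolP[e' [g' [h' [hg' hh' nf']]]].
  apply/asboolP; exists (e + e')%N, (g * g'), (h * h'); split; try exact: dhomogM.
  apply: znearI nf nf' => U SU TU XU; have [hU fU] := SU XU.
  have [hU' fU'] := TU XU; rewrite !pevalM mulf_neq0 //; split=> //.
  by rewrite !fctE fU fU' mulf_div.
Qed.

Definition reg : Type := {f | f \in reg_pred}.
HB.instance Definition _ := SubChoice.copy reg {f | f \in reg_pred}.
HB.instance Definition _ :=
  GRing.SubChoice_isSubComPzRing.Build (grass -> K) reg_pred reg reg_subring.

Definition vanish_near : {pred reg} :=
  fun f => `[< znear P [set U | U \in X -> val f U = 0] >].

Lemma vanish_zmod_closed : zmod_closed vanish_near.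
Proof.
split=> [|f g]; first by apply/asboolP; apply: znearT.
move=> /asboolP nf /asboolP ng; apply/asboolP; apply: znearI nf ng => U fU gU XU.
have -> : val (f - g) = val f - val g by exact: rmorphB.
by rewrite !fctE fU // gU // subrr.
Qed.
HB.instance Definition _ :=
  GRing.isZmodClosed.Build reg vanish_near vanish_zmod_closed.

Lemma vanish_mull (f g : reg) : g \in vanish_near -> f * g \in vanish_near.
Proof.
move=> /asboolP ng; apply/asboolP; apply: (znearI _ ng ng) => U gU _ XU.
have -> : val (f * g) = val f * val g by exact: rmorphM.
by rewrite !fctE gU // mulr0.
Qed.

(* The local ring of X at P: functions regular at P, modulo those vanishing   *)
(* on X near P.  X carries its reduced structure.                             *)
Definition local_ring : Type := Quotient.quot vanish_near.
HB.instance Definition _ := GRing.Zmodule.on local_ring.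

Definition germ (f : reg) : local_ring := \pi_(Quotient.quot vanish_near) f.
Definition germ_mul (x y : local_ring) : local_ring :=
  germ (repr (x : Quotient.quot vanish_near) * repr (y : Quotient.quot vanish_near)).

Lemma germ_eq (f g : reg) : germ f = germ g <-> f - g \in vanish_near.
Proof. by rewrite Quotient.idealrBE; split=> [fg|/eqP //]; apply/eqP. Qed.

Lemma germ_repr (x : local_ring) : exists f, x = germ f.
Proof.
by exists (repr (x : Quotient.quot vanish_near)); rewrite /germ reprK.
Qed.

Lemma germD f g : germ (f + g) = germ f + germ g.
Proof. exact: raddfD. Qed.

Lemma germM f g : germ (f * g) = germ_mul (germ f) (germ g).
Proof.
have [f' f'E] : exists f', f' = repr (germ f : Quotient.quot vanish_near) by eexists.
have [g' g'E] : exists g', g' = repr (germ g : Quotient.quot vanish_near) by eexists.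
have ff' : f - f' \in vanish_near by apply/germ_eq; rewrite f'E /germ reprK.
have gg' : g - g' \in vanish_near by apply/germ_eq; rewrite g'E /germ reprK.
rewrite /germ_mul -f'E -g'E; apply/germ_eq.
rewrite -[f * g](subrK (f * g')) -mulrBr -addrA -mulrBl.
by rewrite rpredD ?(vanish_mull _ gg') // mulrC vanish_mull.
Qed.

Fact germ_mulA : associative germ_mul.
Proof.
move=> x y z; have [f ->] := germ_repr x; have [g ->] := germ_repr y.
by have [h ->] := germ_repr z; rewrite -!germM mulrA.
Qed.
Fact germ_mulC : commutative germ_mul.
Proof.
move=> x y; have [f ->] := germ_repr x; have [g ->] := germ_repr y.
by rewrite -!germM mulrC.
Qed.
Fact germ_mul1 : left_id (germ 1) germ_mul.
Proof. by move=> x; have [f ->] := germ_repr x; rewrite -germM mul1r. Qed.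
Fact germ_mulD : left_distributive germ_mul +%R.
Proof.
move=> x y z; have [f ->] := germ_repr x; have [g ->] := germ_repr y.
by have [h ->] := germ_repr z; rewrite -germD -!germM mulrDl germD.
Qed.
HB.instance Definition _ := GRing.Zmodule_isComPzRing.Build local_ring
  germ_mulA germ_mulC germ_mul1 germ_mulD.

Definition scalar_germ (c : K) : local_ring := germ (Sub (cst c) (reg_cst c)).

Fact scalar_germ_zmod : zmod_morphism scalar_germ.
Proof.
move=> a b; rewrite /scalar_germ -[in RHS](raddfB (\pi_(Quotient.quot vanish_near))).
by congr germ; apply: val_inj; rewrite rmorphB.
Qed.
Fact scalar_germ_monoid : monoid_morphism scalar_germ.
Proof.
split=> [|a b]; first by congr germ; apply: val_inj; rewrite rmorph1.
by rewrite /scalar_germ -[RHS]germM; congr germ; apply: val_inj; rewrite rmorphM.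
Qed.
HB.instance Definition _ :=
  GRing.isZmodMorphism.Build K local_ring scalar_germ scalar_germ_zmod.
HB.instance Definition _ :=
  GRing.isMonoidMorphism.Build K local_ring scalar_germ scalar_germ_monoid.

Definition mult_at : rat := multiplicity scalar_germ.

End LocalRing.
End Grassmannian.

(* Main.v *)
Require Import Defs.
From HB Require Import structures.
From mathcomp Require Import all_boot all_order all_algebra perm.
From mathcomp Require Import boolp classical_sets functions.
From mathcomp Require Import mpoly zify ring.

(* On the chart p_tau != 0 a subspace is the row span of a matrix with the    *)
(* identity in the columns of tau, and the other entries are affine           *)
(* coordinates centred at e_tau.  Split these coordinates into V+ (entries    *)
(* left of the pivot of their row) and V-.  Translations by V+ come from      *)
(* unipotent matrices preserving the flag V_t, so X_w is V+ x Z_w in the      *)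
(* chart; likewise X^v is Z^v x V-, and hence X_w^v is Z^v x Z_w.  All these  *)
(* sets are stable under scaling, by the diagonal torus, so they are cones    *)
(* with vertex e_tau, and m^k / m^(k+1) is the space of degree k polynomial   *)
(* functions on the cone, with basis the standard monomials of degree k.      *)
(* Standard monomials of a product are products of standard monomials, so     *)
(* Hilbert series multiply.  By Dickson's lemma a Hilbert series is           *)
(* Q / (1 - t)^r; normalised so that Q(1) != 0, the multiplicity is Q(1),     *)
(* which is multiplicative and equals 1 for V+ and V-.                        *)

Set Implicit Arguments.
Unset Strict Implicit.
Unset Printing Implicit Defensive.

Import GRing.Theory Num.Theory Order.TTheory.
Local Open Scope ring_scope.

(** * Generating functions and Hilbert polynomials *)

(** The formula comes from a splitting of the tangent directions at [e_tau]. In the chart a subspace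
    is the row span of [axis_mx + mx_of y], and adding a matrix [z] that vanishes in the columns of
    [tau] is right multiplication by the unipotent [1 + axis_mx^T z] ([meets_translate]). If [z]
    lies in the [up_dir] coordinates this matrix preserves every V_t, and if [z] lies in the other
    ones every V^t. So X_w imposes conditions on one half of the coordinates only, X^v on the other
    half, and X_w^v is the product of the two slices Z^v and Z_w, while X_w and X^v are the same
    slices times linear spaces ([has_mult_slices]).

    It remains to see that multiplicity at a vertex is multiplicative on products. For a cone Y the
    degree k forms on Y give m^k / m^(k+1), with basis the monomials of degree k that lead no
    polynomial vanishing on Y ([quot_dim_pow]). This reduces the Hilbert function to counting a
    down-closed set of monomials. That set factors for a product ([standard_product]), so the
    generating functions multiply. They are rational ([gen_fun_down_closed]), and the normalised
    numerator at 1 is the degree of the Hilbert polynomial ([gen_fun_hilbert_degree]).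
    [mult_at_chart] carries this over to the local rings on the Grassmannian. *)

Section TruncatedSeries.
Implicit Types (p q : {poly rat}) (h : nat -> rat).

(** Congruence modulo ['X^N]: a formal power series is handled through all its truncations, so that
    only polynomials occur. *)
Definition eq_upto N p q := forall k, (k < N)%N -> p`_k = q`_k.

Lemma eq_uptoM N p p' q q' :
  eq_upto N p p' -> eq_upto N q q' -> eq_upto N (p * q) (p' * q').
Proof.
move=> hp hq k kN; rewrite !coefM; apply: eq_bigr => j _.
by rewrite hp ?hq //; have := ltn_ord j; lia.
Qed.

Lemma eq_upto_sub1X N p q :
  eq_upto N ((1 - 'X) * p) ((1 - 'X) * q) -> eq_upto N p q.
Proof.
move=> pq k; elim: k => [|k IHk] kN; have := pq _ kN.
  by rewrite !mulrBl !mul1r !coefB !coefXM !subr0.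
rewrite !mulrBl !mul1r !coefB !coefXM /= IHk; last by lia.
by move/(congr1 (+%R^~ q`_k)); rewrite !subrK.
Qed.

Definition trunc N h : {poly rat} := \poly_(i < N) h i.

Lemma coef_trunc N h k : (k < N)%N -> (trunc N h)`_k = h k.
Proof. by move=> kN; rewrite coef_poly kN. Qed.

(* The generating function of h is Q / (1 - t)^r. *)
Definition gen_fun r (Q : {poly rat}) h :=
  forall N, eq_upto N ((1 - 'X) ^+ r * trunc N h) Q.

Lemma eq_gen_fun r Q h h' : h =1 h' -> gen_fun r Q h -> gen_fun r Q h'.
Proof.
by move=> hh' gf N; rewrite /trunc -(eq_poly (E1 := fun i => h i)) // => i _.
Qed.

Lemma gen_fun_conv r1 r2 Q1 Q2 h1 h2 h :
    gen_fun r1 Q1 h1 -> gen_fun r2 Q2 h2 ->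
    (forall k, h k = \sum_(i < k.+1) h1 i * h2 (k - i)%N) ->
  gen_fun (r1 + r2) (Q1 * Q2) h.
Proof.
move=> gf1 gf2 hE N k kN.
rewrite -(eq_uptoM (gf1 N) (gf2 N) kN) exprD mulrACA.
apply: (@eq_uptoM N) => // j jN; rewrite coef_trunc // coefM hE.
by apply: eq_bigr => i _; rewrite !coef_trunc //; have := ltn_ord i; lia.
Qed.

(** The series satisfy H = H0 + t H1; the new numerator puts both terms over the common
    denominator. *)
Lemma gen_fun_shift r0 r1 Q0 Q1 h0 h1 h :
    gen_fun r0 Q0 h0 -> gen_fun r1 Q1 h1 ->
    h 0%N = h0 0%N -> (forall k, h k.+1 = h0 k.+1 + h1 k) ->
  gen_fun (r0 + r1) ((1 - 'X) ^+ r1 * Q0 + (1 - 'X) ^+ r0 * 'X * Q1) h.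
Proof.
move=> gf0 gf1 h00 hS N k kN.
have hT : eq_upto N (trunc N h) (trunc N h0 + 'X * trunc N h1).
  move=> [|j] jN; rewrite coefD coefXM !coef_trunc //= ?addr0 //.
  by lia.
rewrite (@eq_uptoM N _ ((1 - 'X) ^+ (r0 + r1)) _ _ _ hT) //.
have -> : (1 - 'X) ^+ (r0 + r1) * (trunc N h0 + 'X * trunc N h1) =
    (1 - 'X) ^+ r1 * ((1 - 'X) ^+ r0 * trunc N h0) +
    (1 - 'X) ^+ r0 * 'X * ((1 - 'X) ^+ r1 * trunc N h1) :> {poly rat}.
  by rewrite exprD; ring.
rewrite !coefD; congr (_ + _); apply: (@eq_uptoM N) => //.
Qed.

(** Here H = H0 + t H, that is H = H0 / (1 - t). *)
Lemma gen_fun_fixed_shift r Q h0 h :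
    gen_fun r Q h0 -> h 0%N = h0 0%N -> (forall k, h k.+1 = h0 k.+1 + h k) ->
  gen_fun r.+1 Q h.
Proof.
move=> gf0 h00 hS N k kN.
have hT : eq_upto N ((1 - 'X) * trunc N h) (trunc N h0).
  move=> [|j] jN; rewrite mulrBl mul1r coefB coefXM !coef_trunc //= ?subr0 //.
    by rewrite hS addrK.
  by lia.
rewrite -(gf0 N _ kN) exprSr -mulrA.
exact: (@eq_uptoM N).
Qed.

(** Multiplying the series by 1 - t is the backward difference of its coefficients, with value 0
    before index 0. *)
Lemma gen_fun_diff r Q h :
  gen_fun r.+1 Q h -> gen_fun r Q (fun k => h k - (if k is j.+1 then h j else 0)).
Proof.
move=> gf N k kN; rewrite -(gf N _ kN) exprSr -mulrA.
apply: (@eq_uptoM N) kN => // -[|j] jN.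
  by rewrite mulrBl mul1r coefB coefXM !coef_trunc.
rewrite mulrBl mul1r coefB coefXM !coef_trunc //=; exact: ltnW.
Qed.

(** Discrete integration: the backward difference of (c / s) X^s has leading term c X^(s-1), where s
    is the size of [p] and c its leading coefficient. Subtracting it lowers the size, and induction
    does the rest. *)
Lemma poly_antidiff (p : {poly rat}) : p != 0 -> exists P : {poly rat},
  [/\ size P = (size p).+1, (size p)%:R * lead_coef P = lead_coef p &
      forall x, P.[x] - P.[x - 1] = p.[x]].
Proof.
have [m] := ubnP (size p); elim: m p => // m IHm p pm p0.
have sp : (0 < size p)%N by rewrite size_poly_gt0.
set s := size p; set c := lead_coef p.
have c0 : c != 0 by rewrite lead_coef_eq0.
pose b : {poly rat} := (c / s%:R) *: 'X^s.
have s0 : s%:R != 0 :> rat by rewrite pnatr_eq0 -lt0n.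
have cs0 : c / s%:R != 0 by rewrite mulf_neq0 ?invr_neq0.
have szb : size b = s.+1 by rewrite size_scale // size_polyXn.
have lb : lead_coef b = c / s%:R by rewrite lead_coefZ lead_coefXn mulr1.
pose d : {poly rat} := b - (b \Po ('X - 1%:P)).
have dE x : d.[x] = b.[x] - b.[x - 1] by rewrite /d hornerD hornerN horner_comp hornerXsubC.
have expand : exists2 e : {poly rat},
    (size e <= s.-1)%N & ('X - 1%:P) ^+ s = 'X^s - s%:R *: 'X^(s.-1) + e.
  rewrite /s; case: (size p) sp => // j _.
  elim: j => [|j [e se eE]] /=.
    by exists 0; rewrite ?size_poly0 // expr0 !expr1 scale1r addr0.
  exists (j.+1%:R *: 'X^j + ('X - 1%:P) * e).
    apply: leq_trans (size_polyD _ _) _; rewrite geq_max; apply/andP; split.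
      by apply: leq_trans (size_scale_leq _ _) _; rewrite size_polyXn.
    apply: leq_trans (size_polyMleq _ _) _; rewrite size_XsubC; exact: se.
  rewrite exprS eE /= -!mul_polyC /=.
  by rewrite !polyC_natr polyC1 !exprS; ring.
have [e se eE] := expand.
pose q := p - d.
have dpoly : d = c *: 'X^(s.-1) - (c / s%:R) *: e.
  rewrite /d /b linearZ /= comp_Xn_poly eE -scalerBr.
  have -> : c *: 'X^(s.-1) = (c / s%:R) *: (s%:R *: 'X^(s.-1)) :> {poly rat}.
    by rewrite scalerA divfK.
  by rewrite -scalerBr; congr (_ *: _); ring.
have szq : (size q < s)%N.
  have qs : (size q <= s)%N.
    rewrite /q dpoly.
    apply: leq_trans (size_polyD _ _) _; rewrite geq_max leqnn /= size_polyN.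
    apply: leq_trans (size_polyD _ _) _; rewrite geq_max size_polyN.
    apply/andP; split.
      by apply: leq_trans (size_scale_leq _ _) _; rewrite size_polyXn prednK.
    by apply: leq_trans (size_scale_leq _ _) _; apply: leq_trans se (leq_pred _).
  rewrite ltn_neqAle qs andbT; apply/negP => /eqP qsz.
  have q0 : q != 0 by rewrite -size_poly_gt0 qsz.
  move: q0; rewrite -lead_coef_eq0 lead_coefE qsz /q dpoly !coefB !coefZ coefXn.
  rewrite eqxx mulr1 (_ : e`_s.-1 = 0) ?mulr0 ?subr0 -?lead_coefE ?subrr ?eqxx //.
  by apply: nth_default.
have [q0|q0] := eqVneq q 0.
  exists b; split=> //; first by rewrite lb mulrC divfK.
  by move=> x; rewrite -dE; move/eqP: q0; rewrite subr_eq0 => /eqP ->.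
have [P [sP lP PE]] := IHm q (leq_trans szq pm) q0.
exists (b + P); split.
- by rewrite size_polyDl szb // sP.
- by rewrite lead_coefDl ?szb ?sP // lb mulrC divfK.
- move=> x; rewrite !hornerD.
  have -> : b.[x] + P.[x] - (b.[x - 1] + P.[x - 1]) = d.[x] + q.[x].
    by rewrite dE -PE; ring.
  by rewrite /q hornerD hornerN addrC subrK.
Qed.

Lemma gen_fun_poly r Q h : gen_fun r.+1 Q h -> Q.[1] != 0 ->
  exists p N, [/\ size p = r.+1, r`!%:R * lead_coef p = Q.[1] &
    forall k, (N <= k)%N -> p.[k%:R] = h k].
Proof.
elim: r h => [|r IHr] h gf Q1.
  (* With denominator 1 - t, [h k] is a partial sum of the coefficients of [Q], hence equal to Q(1)
     once all of them are included. *)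
  exists (Q.[1])%:P, (size Q); rewrite size_polyC Q1 lead_coefC mul1r; split=> //.
  move=> k szk; rewrite hornerC horner_coef.
  have hE j : h j = \sum_(i < j.+1) Q`_i.
    elim: j => [|j IHj].
      have := gen_fun_diff gf (N := 1) (k := 0) isT.
      by rewrite expr0 mul1r coef_trunc // subr0 big_ord1.
    have := gen_fun_diff gf (N := j.+2) (k := j.+1) (ltnSn _).
    rewrite expr0 mul1r coef_trunc // => /(canRL (subrK _)) ->.
    by rewrite [RHS]big_ord_recr /= IHj addrC.
  rewrite hE (big_ord_widen k.+1 (fun i => Q`_i * 1 ^+ i)); last by rewrite ltnW.
  rewrite big_mkcond; apply: eq_bigr => i _; rewrite expr1n mulr1.
  by case: ltnP => // /(nth_default 0) ->.
have [p [N [sp lp pE]]] := IHr _ (gen_fun_diff gf) Q1.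
have p0 : p != 0 by rewrite -size_poly_gt0 sp.
have [P [sP lP PE]] := poly_antidiff p0.
(* The constant makes the values agree at [N]; from there on the backward differences agree. *)
exists (P + (h N - P.[N%:R])%:P), N; split.
- by rewrite size_polyDl ?sP ?sp // size_polyC; case: (_ == _).
- rewrite lead_coefDl ?sP ?sp ?size_polyC; last by case: (_ == _).
  by rewrite factS natrM mulrAC -[in r.+1%:R]sp lP mulrC.
move=> k Nk; rewrite -(subnK Nk); elim: (k - N)%N => [|j IHj].
  by rewrite add0n hornerD hornerC addrC subrK.
move: IHj; rewrite !hornerD !hornerC addSn => IHj.
have := PE (j + N).+1%:R; rewrite pE; last by lia.
rewrite -natr1 addrK => /(canRL (subrK _)) ->; rewrite -addrA IHj; ring.
Qed.

(** While Q(1) = 0, a factor 1 - t cancels against the denominator. If the denominator is exhausted,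
    Q(1) is a sum of values of [h], positive because [h 0 = 1]. *)
Lemma gen_fun_normalize r Q (h : nat -> nat) :
    gen_fun r Q (fun k => (h k)%:R) -> h 0%N = 1%N ->
  exists r' Q', gen_fun r' Q' (fun k => (h k)%:R) /\ Q'.[1] != 0.
Proof.
elim: r Q => [|r IHr] Q gf h0.
  exists 0%N, Q; split=> //.
  have QE k : Q`_k = (h k)%:R.
    by rewrite -(gf k.+1 k) // expr0 mul1r coef_trunc.
  rewrite horner_coef.
  have sQ : (0 < size Q)%N.
    rewrite size_poly_gt0; apply/eqP => Q0.
    by have := QE 0%N; rewrite Q0 coef0 h0 => /eqP; rewrite eq_sym oner_eq0.
  rewrite gt_eqF //; case: (size Q) sQ => // s _.
  rewrite big_ord_recl QE h0 expr1n mulr1 ltr_wpDr //.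
  by apply: sumr_ge0 => i _; rewrite QE expr1n mulr1 ler0n.
have [Q1|Q1] := eqVneq Q.[1] 0; last by exists r.+1, Q.
have /factor_theorem[Q' QQ'] : root Q 1 by apply/eqP.
(* The sign appears because the factor theorem extracts X - 1 and the denominator is a power of 1 -
   X. *)
apply: (IHr (- Q')) => // N; apply: eq_upto_sub1X => k kN.
rewrite mulrA -exprS gf // (_ : _ * - Q' = Q) //.
by rewrite QQ' polyC1; ring.
Qed.

(** For [r = 0] the Hilbert polynomial is 0 and [hilbert_degree] takes its conventional value 1. The
    last hypothesis then forces [h] to vanish in positive degrees, so that [Q = 1] and the two
    values agree. *)
Lemma gen_fun_hilbert_degree r Q (h : nat -> nat) :
    gen_fun r Q (fun k => (h k)%:R) -> Q.[1] != 0 -> h 0%N = 1%N ->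
    (forall k, h k = 0%N -> forall j, (0 < j)%N -> h j = 0%N) ->
  exists p N, hilbert_degree p = Q.[1] /\
    forall k, (N <= k)%N -> p.[k%:R] = (h k)%:R.
Proof.
case: r => [|r] gf Q1 h0 hz; last first.
  have [p [N [sp lp pE]]] := gen_fun_poly gf Q1.
  by exists p, N; rewrite /hilbert_degree -size_poly_eq0 sp.
have QE k : Q`_k = (h k)%:R.
  by rewrite -(gf k.+1 k) // expr0 mul1r coef_trunc.
have hz1 j : (0 < j)%N -> h j = 0%N.
  apply: hz (size Q) _ _; apply/eqP; rewrite -(pnatr_eq0 rat) -QE.
  by rewrite nth_default.
exists 0, 1%N; split=> [|k k0]; last by rewrite horner0 hz1.
rewrite /hilbert_degree eqxx.
suff -> : Q = 1 by rewrite hornerC.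
apply/polyP => -[|k]; rewrite QE coef1 ?h0 //= hz1 //.
Qed.

End TruncatedSeries.

(** * Counting monomials *)

Section Monomials.
Variable n : nat.
Implicit Types (P : pred 'I_n) (u a b m : 'X_{1..n}) (D : pred 'X_{1..n}) (k : nat).

Definition mons D k : seq 'X_{1..n} :=
  [seq u <- [seq bmnm x | x : 'X_{1..n < k.+1}] | (mdeg u == k) && D u].

Lemma mons_uniq D k : uniq (mons D k).
Proof.
apply: filter_uniq; rewrite map_inj_uniq ?enum_uniq //; exact: val_inj.
Qed.

Lemma mem_mons D k u : (u \in mons D k) = (mdeg u == k) && D u.
Proof.
rewrite mem_filter andb_idr // => /andP[/eqP uk _].
have uk1 : (mdeg u < k.+1)%N by rewrite uk.
by apply/mapP; exists (BMultinom uk1) => //; rewrite mem_enum.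
Qed.

Definition count_mons D k : nat := size (mons D k).

Lemma count_monsE D k (s : seq 'X_{1..n}) :
  uniq s -> (forall u, (u \in s) = (mdeg u == k) && D u) -> count_mons D k = size s.
Proof.
move=> us sE; apply/perm_size/uniq_perm => // [|u]; first exact: mons_uniq.
by rewrite mem_mons sE.
Qed.

Lemma eq_count_mons D D' : D =1 D' -> count_mons D =1 count_mons D'.
Proof.
by move=> DD' k; apply: count_monsE (mons_uniq _ _) _ => u; rewrite mem_mons DD'.
Qed.

Lemma count_mons0 D : count_mons D 0 = D 0%MM.
Proof.
rewrite (@count_monsE _ _ (nseq (D 0%MM) 0%MM)) ?size_nseq //; first by case: (D _).
move=> u; rewrite mdeg_eq0; case D0: (D 0%MM); rewrite /= ?inE.
  by case: eqP => // ->.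
by case: eqP => // ->.
Qed.

(** [slice] and [shift] are the monomial forms of the quotient by x_i and of the colon by x_i. *)
Definition slice i D : pred 'X_{1..n} := fun u => (u i == 0)%N && D u.
Definition shift i D : pred 'X_{1..n} := fun u => D (u + U_(i))%MM.

Lemma count_mons_slice_shift i D k :
  count_mons D k.+1 = (count_mons (slice i D) k.+1 + count_mons (shift i D) k)%N.
Proof.
rewrite (@count_monsE _ _ (mons (slice i D) k.+1 ++
    [seq (u + U_(i))%MM | u <- mons (shift i D) k])) ?size_cat ?size_map //.
  rewrite cat_uniq mons_uniq map_inj_uniq ?mons_uniq ?andbT; last exact: addIm.
  apply/hasPn => _ /mapP[u _ ->]; rewrite mem_mons /slice mnmDE mnm1E eqxx.
  by rewrite addn1 andbF.
move=> u; rewrite mem_cat mem_mons /slice.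
have [ui|ui] := eqVneq (u i) 0%N.
  rewrite andTb orb_idr // => /mapP[x _ ux].
  by move: ui; rewrite ux mnmDE mnm1E eqxx addn1.
rewrite andFb andbF orFb.
have uE : (u - U_(i) + U_(i))%MM = u by rewrite submK // lep1mP.
apply/mapP/andP => [[x]|[uk Du]].
  by rewrite mem_mons => /andP[/eqP xk xD] ->; rewrite mdegD mdeg1 xk addn1 eqxx.
exists (u - U_(i))%MM => //; rewrite mem_mons /shift uE Du andbT.
by move: uk; rewrite -[in mdeg u]uE mdegD mdeg1 addn1 eqSS.
Qed.

Definition restrict (P : pred 'I_n) u : 'X_{1..n} :=
  [multinom if P i then u i else 0%N | i < n].

Lemma restrictE P u i : restrict P u i = if P i then u i else 0%N.
Proof. exact: mnmE. Qed.

Lemma restrictD P u : (restrict P u + restrict (predC P) u)%MM = u.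
Proof.
apply/mnmP => i; rewrite mnmDE !restrictE /=.
by case: (P i); rewrite ?addn0 ?add0n.
Qed.

Lemma restrict_id P u : (forall i, u i != 0%N -> P i) -> restrict P u = u.
Proof.
move=> uP; apply/mnmP => i; rewrite restrictE.
by case: ifPn => // /(contraNN (uP i)); rewrite negbK => /eqP ->.
Qed.

Lemma restrict_eqP P u :
  (restrict P u == u) = [forall i, ~~ P i ==> (u i == 0%N)].
Proof.
apply/eqP/forallP => [<- i|H0]; first by rewrite restrictE; case: (P i).
by apply: restrict_id => i; apply: contraR => Pi; have := H0 i; rewrite Pi.
Qed.

Lemma restrictDl P a b : restrict P a = a -> restrict (predC P) b = b ->
  restrict P (a + b) = a.
Proof.
move=> aP bP; apply/mnmP => i; rewrite restrictE mnmDE -{2}aP restrictE.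
by case: ifPn => // Pi; rewrite -bP restrictE /= Pi addn0.
Qed.

Lemma restrictDr P a b : restrict P a = a -> restrict (predC P) b = b ->
  restrict (predC P) (a + b) = b.
Proof.
move=> aP bP; apply/mnmP => i; rewrite restrictE mnmDE /= -{2}bP restrictE /=.
by case: ifPn => // Pi; rewrite -aP restrictE (negbTE Pi).
Qed.

Definition prod_pred P D1 D2 : pred 'X_{1..n} :=
  fun u => D1 (restrict P u) && D2 (restrict (predC P) u).

(** A monomial factors uniquely into its part in the variables of [P] and its part in the others,
    and the degrees add. *)
Lemma count_mons_prod P D1 D2 k :
    (forall u, D1 u -> restrict P u = u) ->
    (forall u, D2 u -> restrict (predC P) u = u) ->
  count_mons (prod_pred P D1 D2) k =
  (\sum_(i < k.+1) count_mons D1 i * count_mons D2 (k - i))%N.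
Proof.
move=> P1 P2.
pose s := [seq (a + b)%MM | a <- [seq a | i <- iota 0 k.+1, a <- mons D1 i],
                            b <- mons D2 (k - mdeg a)%N].
have mem_l a : (a \in [seq a | i <- iota 0 k.+1, a <- mons D1 i]) =
               (mdeg a <= k)%N && D1 a.
  apply/allpairsPdep/andP => [[i [x [ik xi ->]]]|[ak Da]].
    move: ik xi; rewrite mem_iota mem_mons add0n => /= ik.
    by case/andP => /eqP ->; rewrite -ltnS.
  by exists (mdeg a), a; rewrite mem_iota add0n ltnS mem_mons eqxx.
rewrite (@count_monsE _ _ s).
- rewrite /s size_allpairs_dep sumnE big_map.
  rewrite -[iota 0 k.+1]/(index_iota 0 k.+1) -(big_mkord xpredT
    (fun i => count_mons D1 i * count_mons D2 (k - i)))%N.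
  rewrite [LHS]big_allpairs_dep; apply: eq_bigr => i _.
  rewrite big_seq (eq_bigr (fun _ => count_mons D2 (k - i)%N)); last first.
    by move=> a; rewrite mem_mons => /andP[/eqP -> _].
  by rewrite -big_seq big_const_seq count_predT iter_addn_0 mulnC.
- apply: allpairs_uniq_dep => [|a _|]; last 1 first.
  + move=> x y /allpairsPdep[a [b [al bl ->]]] /allpairsPdep[a' [b' [al' bl' ->]]] /=.
    move: al al' bl bl'; rewrite !mem_l !mem_mons => /andP[_ a1] /andP[_ a1'].
    move=> /andP[_ b2] /andP[_ b2'] e.
    have ea : a = a'.
      by rewrite -(restrictDl (P1 _ a1) (P2 _ b2)) e restrictDl ?P1 ?P2.
    by move: e; rewrite ea => /addmI ->.
  + apply: allpairs_uniq_dep => [|i _|]; [exact: iota_uniq|exact: mons_uniq|].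
    move=> x y /allpairsPdep[i [a [_ al ->]]] /allpairsPdep[j [b [_ bl ->]]] /= ab.
    move: al bl; rewrite !mem_mons ab => /andP[/eqP <- _] /andP[/eqP <- _].
    by [].
  + exact: mons_uniq.
- move=> u; apply/allpairsPdep/andP => [[a [b []]]|[/eqP uk /andP[D1u D2u]]].
    rewrite mem_l mem_mons => /andP[ak Da] /andP[/eqP bk Db] ->.
    by rewrite mdegD bk subnKC // eqxx /prod_pred restrictDl ?restrictDr ?P1 ?P2 ?Da.
  exists (restrict P u), (restrict (predC P) u); rewrite restrictD mem_l mem_mons.
  rewrite D1u D2u !andbT; move: uk; rewrite -[in mdeg u](restrictD P u) mdegD => <-.
  by rewrite leq_addr addKn eqxx.
Qed.

End Monomials.

(** * Dickson's lemma and rationality of Hilbert series *)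

Section Dickson.

(** Choose repeatedly an index at which [f] is minimal on the remaining tail. *)
Lemma nondecreasing_subseq (f : nat -> nat) : exists phi : nat -> nat,
  (forall i j, (i < j)%N -> (phi i < phi j)%N) /\
  (forall i j, (i <= j)%N -> (f (phi i) <= f (phi j))%N).
Proof.
have minE a : {m | (a <= m)%N /\ forall j, (a <= j)%N -> (f m <= f j)%N}.
  apply: cid; pose V v := `[< exists2 m, (a <= m)%N & f m = v >].
  have exV : exists v, V v by exists (f a); apply/asboolP; exists a.
  case: (ex_minnP exV) => v /asboolP[m am fm] vmin; exists m; split=> // j aj.
  by rewrite fm; apply: vmin; apply/asboolP; exists j.
pose g a := sval (minE a).
have gle a : (a <= g a)%N by rewrite /g; case: (minE a) => m [].
have gmin a j : (a <= j)%N -> (f (g a) <= f j)%N.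
  by rewrite /g; case: (minE a) => m [] /= _; apply.
pose phi := fix phi i := if i is i'.+1 then g (phi i').+1 else g 0%N.
have phiS i : (phi i < phi i.+1)%N by exact: (gle (phi i).+1).
have philt i j : (i < j)%N -> (phi i < phi j)%N.
  by move=> ij; apply: (homo_ltn ltn_trans phiS).
exists phi; split=> // i j.
rewrite leq_eqVlt => /predU1P[-> //|/philt ij].
by case: i ij => [|i] ij; apply: gmin => //; apply: leq_trans ij; rewrite ltnS ltnW.
Qed.

(** Extracting subsequences one variable at a time makes all exponents nondecreasing; the first two
    terms are then comparable. *)
Lemma dickson n (u : nat -> 'X_{1..n}) :
  exists i j, (i < j)%N /\ (u i <= u j)%MM.
Proof.
suff [phi [philt phiu]] : exists phi : nat -> nat,
    (forall i j, (i < j)%N -> (phi i < phi j)%N) /\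
    forall c, c \in enum 'I_n -> forall i j, (i <= j)%N -> (u (phi i) c <= u (phi j) c)%N.
  exists (phi 0%N), (phi 1%N); split; first exact: philt.
  by apply/mnm_lepP => c; apply: phiu; rewrite ?mem_enum.
elim: (enum 'I_n) => [|c l [phi [philt phiu]]]; first by exists id.
have [psi [psilt psiu]] := nondecreasing_subseq (fun i => u (phi i) c).
exists (phi \o psi); split=> [i j ij|c']; first exact/philt/psilt.
rewrite inE => /predU1P[->|c'l] i j ij; first exact: psiu.
apply: phiu => //; case: (ltngtP i j) ij => // [/psilt/ltnW //|-> //].
Qed.

Definition down_closed n (D : pred 'X_{1..n}) :=
  forall u v, (u <= v)%MM -> D v -> D u.

(** If the chain dropped a monomial u_J at every step, Dickson's lemma would give i < j with u_i
    dividing u_j. Since u_j lies in [E j], hence in [E i.+1], so would u_i, which was dropped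
    there. *)
Lemma down_closed_chain n (E : nat -> pred 'X_{1..n}) :
    (forall j, down_closed (E j)) -> (forall j u, E j.+1 u -> E j u) ->
  exists J, E J.+1 =1 E J.
Proof.
move=> Edc EE.
have Ele i j u : (i <= j)%N -> E j u -> E i u.
  by move=> /subnK <-; elim: (j - i)%N => // k IHk /EE/IHk.
apply: contrapT => noJ.
have ex J : {u | E J u /\ ~~ E J.+1 u}.
  apply: cid; apply: contrapT => noU; apply: noJ; exists J => u.
  apply/idP/idP => [/EE //|EJu]; apply/negPn/negP => nE; apply: noU.
  by exists u.
have [i [j [ij le]]] := dickson (fun J => sval (ex J)).
case: (ex i) (ex j) le => [u [_ nu]] [v [vj _]] /= uv.
by move/negP: nu; apply; apply: Ele ij _; apply: Edc uv vj.
Qed.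

(** Induction on the variables that occur. The iterated colons [E j] by x_i decrease, hence
    stabilise at some [J], where the series is that of a slice divided by 1 - t. A descent from [J]
    to 0 adds one slice at a time, and slices involve fewer variables. *)
Lemma gen_fun_down_closed n (D : pred 'X_{1..n}) : down_closed D ->
  exists r Q, gen_fun r Q (fun k => (count_mons D k)%:R).
Proof.
have : forall u, D u -> forall i, u i != 0%N -> i \in enum 'I_n.
  by move=> u _ i _; rewrite mem_enum.
elim: (enum 'I_n) D => [|i l IHl] D Dl Ddc.
  exists 0%N, (D 0%MM)%:R%:P => N k kN; rewrite expr0 mul1r coef_trunc // coefC.
  case: k kN => [|k] kN; first by rewrite count_mons0.
  rewrite (@count_monsE _ _ _ [::]) // => u; rewrite in_nil.
  apply/esym/negP => /andP[/eqP uk /Dl u0].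
  have uz : u = 0%MM.
    by apply/mnmP => j; rewrite mnm0E; apply/eqP; apply: contraT => /u0.
  by move: uk; rewrite uz mdeg0.
pose E j := iter j (shift i) D.
have Edc j : down_closed (E j).
  elim: j => [//|j IHj] u v uv; rewrite /E /= /shift; apply: IHj.
  by apply/mnm_lepP => c; rewrite !mnmDE leq_add2r; apply/mnm_lepP.
have EE j u : E j.+1 u -> E j u by apply: (Edc j u (u + U_(i))%MM); exact: lem_addr.
have El j u : E j u -> D u.
  by elim: j => // j IHj /EE/IHj.
have [J EJ] := down_closed_chain Edc EE.
have slice_gf j : exists r Q, gen_fun r Q (fun k => (count_mons (slice i (E j)) k)%:R).
  apply: IHl => [u /andP[/eqP ui /El/Dl uD] c uc|u v uv /andP[/eqP vi vE]].
    by have := uD c uc; rewrite inE => /predU1P[ci|//]; rewrite ci ui in uc.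
  rewrite /slice (Edc _ _ _ uv vE) andbT -leqn0 -vi; exact/mnm_lepP.
have slice0 F : count_mons F 0 = count_mons (slice i F) 0.
  by rewrite !count_mons0 /slice mnm0E eqxx.
suff : forall m, exists r Q, gen_fun r Q (fun k => (count_mons (E (J - m)%N) k)%:R).
  by move/(_ J); rewrite subnn.
elim=> [|m [r [Q gf]]].
  rewrite subn0; have [r [Q gf]] := slice_gf J; exists r.+1, Q.
  apply: gen_fun_fixed_shift gf _ _ => [|k]; first by rewrite slice0.
  rewrite (count_mons_slice_shift i) natrD; congr (_ + _%:R).
  exact: eq_count_mons.
have [Jm|Jm] := leqP J m.
  by exists r, Q; rewrite (_ : J - m.+1 = J - m)%N //; lia.
have [r0 [Q0 gf0]] := slice_gf (J - m.+1)%N.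
eexists; eexists; apply: gen_fun_shift gf0 gf _ _ => [|k]; first by rewrite slice0.
rewrite (count_mons_slice_shift i) natrD; congr (_ + _%:R).
apply: eq_count_mons => u; rewrite (_ : J - m = (J - m.+1).+1)%N //; lia.
Qed.

Lemma gen_fun_restrict n (P : pred 'I_n) :
  exists r, gen_fun r 1 (fun k => (count_mons (fun u => restrict P u == u) k)%:R).
Proof.
suff H (l : seq 'I_n) : uniq l -> exists r,
    gen_fun r 1 (fun k => (count_mons (fun u => restrict (mem l) u == u) k)%:R).
  have [|r gf] := H (enum P); first exact: enum_uniq.
  exists r; apply: eq_gen_fun gf => k; congr _%:R; apply: eq_count_mons => u.
  congr (_ == _); apply/mnmP => i; rewrite !restrictE /=.
  by rewrite mem_enum.
elim: l => [_|i l IHl /= /andP[il /IHl[r gf]]].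
  exists 0%N => N k kN; rewrite expr0 mul1r coef_trunc //.
  case: k kN => [|k] kN; rewrite coef1.
    by rewrite count_mons0 restrict_eqP; case: forallP => // -[] c; rewrite mnm0E implybT.
  rewrite (@count_monsE _ _ _ [::]) // => u; rewrite in_nil.
  apply/esym/negP => /andP[/eqP uk /eqP u0]; move: uk; rewrite -u0 mdegE big1 // => c _.
  by rewrite restrictE.
exists r.+1; apply: gen_fun_fixed_shift gf _ _ => [|k].
  have r0 (Q : pred 'I_n) : restrict Q 0%MM == 0%MM.
    by rewrite restrict_eqP; apply/forallP => c; rewrite mnm0E implybT.
  by rewrite !count_mons0 !r0.
rewrite (count_mons_slice_shift i) natrD; congr (_%:R + _%:R); apply: eq_count_mons => u.
  rewrite /slice !restrict_eqP; apply/andP/forallP => [[/eqP ui /forallP H0] c|H0].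
    have := H0 c; rewrite /= inE negb_or; case: (eqVneq c i) => //= ->.
    by rewrite ui eqxx implybT.
  split; first by have := H0 i; rewrite /= il.
  by apply/forallP => c; have := H0 c; rewrite /= inE negb_or; case: (c \in l); rewrite ?andbF ?andbT //= => ->; rewrite implybT.
rewrite /shift !restrict_eqP; apply: eq_forallb => c; rewrite mnmDE mnm1E /= inE.
by case: (eqVneq c i) => [->|ci] //=; rewrite addn0.
Qed.

End Dickson.

(** * Standard monomials of a set of points *)

Section StandardMonomials.
Variables (K : fieldType) (n : nat).
Implicit Types (p q : {mpoly K[n]}) (u m : 'X_{1..n}) (y : 'I_n -> K).
Implicit Types (P : pred 'I_n) (Y : set ('I_n -> K)).

Lemma mpolyX_neq0 u : 'X_[u] != 0 :> {mpoly K[n]}.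
Proof. by rewrite -msupp_eq0 msuppX. Qed.

Definition vanishes Y p := forall y, Y y -> p.@[y] = 0.

(** The complement of the initial ideal of the ideal of [Y]. *)
Definition standard Y u : bool :=
  `[< forall p, p != 0 -> vanishes Y p -> mlead p != u >].

Lemma nonstandardP Y u :
  ~~ standard Y u -> exists p, [/\ p != 0, vanishes Y p & mlead p = u].
Proof.
move=> /asboolPn/existsNP[p] /not_implyP[p0] /not_implyP[pY] /negP.
by rewrite negbK => /eqP pu; exists p.
Qed.

Lemma standard_down_closed Y : down_closed (standard Y).
Proof.
move=> u v uv; apply: contraLR => /nonstandardP[p [p0 pY pu]].
apply/asboolPn/existsNP; exists (p * 'X_[v - u]).
rewrite !not_implyE mulf_neq0 ?mpolyX_neq0 //; split=> //; split.
  by move=> y Yy; rewrite mevalM pY // mul0r.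
apply/negP; rewrite negbK mleadM ?mpolyX_neq0 // mleadXm pu addmC submK //.
Qed.

Lemma standard_independent Y p :
  vanishes Y p -> (forall m, m \in msupp p -> standard Y m) -> p = 0.
Proof.
move=> pY pS; apply/eqP; apply: contraT => p0.
by have /asboolP/(_ p p0 pY) := pS _ (mlead_supp p0); rewrite eqxx.
Qed.

(** Division with remainder, for any [S] whose complement consists of leading monomials; it thus
    applies to the candidate set of a product before that set is known to be the standard one. The
    last clause says that no monomial above the support of [p] enters the remainder. *)
Lemma reduce Y (S : pred 'X_{1..n}) p :
    (forall u, ~~ S u -> exists r, [/\ r != 0, vanishes Y r & mlead r = u]) ->
  exists q, [/\ vanishes Y (p - q), forall m, m \in msupp q -> S m &
    forall m, (forall m', m' \in msupp p -> (m' < m)%O) -> q@_m = 0].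
Proof.
move=> SY; elim/mleadrect: p => p IHp.
have [->|p0] := eqVneq p 0.
  exists 0; split=> [y _|m|m _]; rewrite ?subrr ?meval0 ?msupp0 ?mcoeff0 //.
set u := mlead p.
have pu0 : p@_u != 0 by rewrite mleadc_eq0.
(* The leading term of [p] is either kept, as [t], when its monomial is in [S], or cancelled by a
   vanishing polynomial [s]. *)
suff [t [s [tu tS sY]]] : exists t s, [/\ mlead (t + s) = u /\ (t + s)@_u = p@_u,
    (forall m, m \in msupp t -> S m /\ m = u) & vanishes Y s].
  pose p' := p - (t + s).
  have p'u : p'@_u = 0 by rewrite mcoeffB tu.2 subrr.
  have p'le m : m \in msupp p' -> (m < u)%O.
    rewrite lt_neqAle => mp'; apply/andP; split.
      by apply: contraTneq mp' => ->; rewrite -mcoeff_eq0 p'u.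
    apply: le_trans (msupp_le_mlead mp') _; apply: le_trans (mleadB_le _ _) _.
    by rewrite leUx lexx tu.1 lexx.
  have [q [qY qS q0]] : exists q, [/\ vanishes Y (p' - q),
      forall m, m \in msupp q -> S m &
      forall m, (forall m', m' \in msupp p' -> (m' < m)%O) -> q@_m = 0].
    have [->|p'0] := eqVneq p' 0; last by apply/IHp/p'le/mlead_supp.
    by exists 0; split=> [y _|m|m _]; rewrite ?subrr ?meval0 ?msupp0 ?mcoeff0.
  exists (t + q); split.
  - move=> y Yy; rewrite (_ : p - (t + q) = p' - q + s); last by rewrite /p'; ring.
    by rewrite mevalD qY // sY // addr0.
  - move=> m /msuppD_le; rewrite mem_cat => /orP[/tS[]//|]; exact: qS.
  - move=> m pm; rewrite mcoeffD q0 ?addr0 => [|m' /p'le m'u].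
      apply: memN_msupp_eq0; apply/negP => /tS[_ mu].
      by have := pm _ (mlead_supp p0); rewrite mu ltxx.
    by apply: lt_trans m'u _; apply/pm/mlead_supp.
case: (boolP (S u)) => [Su|/SY[r [r0 rY ru]]].
  exists (p@_u *: 'X_[u]), 0; rewrite addr0 mleadZ // mleadXm mcoeffZ mcoeffX eqxx.
  rewrite mulr1; split=> // [m|y _]; last by rewrite meval0.
  by rewrite msuppMCX // inE => /eqP ->.
have ru0 : r@_u != 0 by rewrite -ru mleadc_eq0.
exists 0, ((p@_u / r@_u) *: r); rewrite add0r mcoeffZ divfK //; split.
- by rewrite mleadZ // mulf_neq0 ?invr_eq0.
- by move=> m; rewrite msupp0.
- by move=> y Yy; rewrite mevalZ rY // mulr0.
Qed.

Lemma reduce_standard Y p :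
  exists2 q, vanishes Y (p - q) & forall m, m \in msupp q -> standard Y m.
Proof.
by have [u|q [qY qS _]] := @reduce Y (standard Y) p; [exact: nonstandardP|exists q].
Qed.

Definition cut P y : 'I_n -> K := fun i => if P i then y i else 0.

Lemma mevalX_cut P y u : 'X_[restrict P u].@[cut P y] = 'X_[restrict P u].@[y].
Proof.
rewrite !mevalX; apply: eq_bigr => i _; rewrite restrictE /cut.
by case: ifP; rewrite ?expr0.
Qed.

Lemma mevalX_cut0 P y u : restrict P u != u -> 'X_[u].@[cut P y] = 0.
Proof.
move=> uP; rewrite mevalX.
suff [i Pi ui] : exists2 i, ~~ P i & u i != 0%N.
  by rewrite (bigD1 i) //= /cut (negbTE Pi) expr0n (negbTE ui) mul0r.
apply: contrapT => noi; move/negP: uP; apply; apply/eqP.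
by apply: restrict_id => i ui; apply: contrapT => /negP Pi; apply: noi; exists i.
Qed.

Lemma standard_cut P Y u : (forall y, Y y -> cut P y = y) ->
  standard Y u -> restrict P u = u.
Proof.
move=> YP /asboolP uS; apply/eqP; apply: contraT => uP.
have uY : vanishes Y 'X_[u] by move=> y /YP <-; apply: mevalX_cut0.
by have := uS _ (mpolyX_neq0 u) uY; rewrite mleadXm eqxx.
Qed.

Lemma meval_cut P p : exists p', (forall y, p'.@[y] = p.@[cut P y]) /\
  forall m, p'@_m = if restrict P m == m then p@_m else 0.
Proof.
exists (\sum_(m <- msupp p | restrict P m == m) p@_m *: 'X_[m]); split.
  move=> y; rewrite [in RHS](mpolyE p) !raddf_sum /= big_mkcond; apply: eq_bigr => m _.
    case: ifPn => [/eqP mP|mP]; rewrite !mevalZ; last by rewrite mevalX_cut0 ?mulr0.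
  by rewrite -mP mevalX_cut mP.
move=> m; rewrite raddf_sum /= big_mkcond /=.
have [mp|mp] := boolP (m \in msupp p); last first.
  rewrite (memN_msupp_eq0 mp) if_same big_seq big1 // => m' m'p.
  case: ifP => // _; rewrite mcoeffZ mcoeffX.
  by case: eqP => [e|]; [rewrite -e m'p in mp|rewrite mulr0].
rewrite (bigD1_seq m) ?msupp_uniq //= big1 ?addr0.
  by case: ifP => // _; rewrite mcoeffZ mcoeffX eqxx mulr1.
by move=> m' /negbTE mm'; case: ifP => // _; rewrite mcoeffZ mcoeffX mm' mulr0.
Qed.

(** * Standard monomials of a product *)

Section Product.
Variables (P : pred 'I_n) (Y1 Y2 Y : set ('I_n -> K)).
Hypothesis Y1P : forall y, Y1 y -> cut P y = y.
Hypothesis Y2P : forall y, Y2 y -> cut (predC P) y = y.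
Hypothesis YE : forall y, Y y <-> Y1 (cut P y) /\ Y2 (cut (predC P) y).

Let S := prod_pred P (standard Y1) (standard Y2).

(** A polynomial vanishing on the factor [Z] keeps its leading monomial when the variables outside
    [Q] are set to 0. Multiplying by the rest of [u] then yields leading monomial [u]. *)
Lemma nonstandard_factor Q Z u : (forall y, Y y -> Z (cut Q y)) ->
  ~~ standard Z (restrict Q u) -> exists r, [/\ r != 0, vanishes Y r & mlead r = u].
Proof.
move=> YZ /nonstandardP[p [p0 pZ pu]]; have [p' [p'E p'c]] := meval_cut Q p.
have p'u : p'@_(restrict Q u) = p@_(restrict Q u).
  by rewrite p'c; case: eqP => // -[]; apply: restrict_id => i; rewrite restrictE; case: (Q i).
have pu0 : p@_(restrict Q u) != 0 by rewrite -pu mleadc_eq0.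
have p'0 : p' != 0 by apply: contraNneq pu0 => p'0; rewrite -p'u p'0 mcoeff0.
have lp' : mlead p' = restrict Q u.
  apply/le_anti; rewrite [X in _ && X]msupp_le_mlead; last first.
    by rewrite mcoeff_msupp p'u.
  rewrite andbT -pu; apply: msupp_le_mlead; rewrite mcoeff_msupp.
  by apply: contraTneq (mlead_supp p'0) => e; rewrite mcoeff_msupp p'c e if_same eqxx.
exists (p' * 'X_[restrict (predC Q) u]); split.
- by rewrite mulf_neq0 ?mpolyX_neq0.
- by move=> y /YZ Zy; rewrite mevalM p'E pZ // mul0r.
- by rewrite mleadM ?mpolyX_neq0 // lp' mleadXm restrictD.
Qed.

(** The tensor product argument: for fixed [y2] in [Y2], [p] becomes a combination of standard
    monomials of [Y1] and vanishes on [Y1], so it is 0. Its coefficients, as functions of [y2], are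
    combinations of standard monomials of [Y2] that vanish on [Y2], so they are 0 too. *)
Lemma product_independent p :
  vanishes Y p -> (forall m, m \in msupp p -> S m) -> p = 0.
Proof.
move=> pY pS.
pose py y2 : {mpoly K[n]} :=
  \sum_(m <- msupp p) (p@_m * 'X_[restrict (predC P) m].@[y2]) *: 'X_[restrict P m].
have py0 y2 : Y2 y2 -> py y2 = 0.
  move=> Y2y2; apply: (@standard_independent Y1) => [y1 Y1y1|m]; last first.
    move/msupp_sum_le => /flatten_mapP[m']; rewrite filter_predT => m'p.
    move/msuppZ_le; rewrite msuppX inE => /eqP ->.
    by have /andP[] := pS _ m'p.
  pose y i := if P i then y1 i else y2 i.
  have cy1 : cut P y = y1.
    apply/funext => i; rewrite -[in RHS](Y1P Y1y1) /cut /y; by case: (P i).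
  have cy2 : cut (predC P) y = y2.
    apply/funext => i; rewrite -[in RHS](Y2P Y2y2) /cut /y /=; by case: (P i).
  have Yy : Y y by apply/YE; rewrite cy1 cy2.
  rewrite -(pY _ Yy) [in RHS](mpolyE p) !raddf_sum /=; apply: eq_bigr => m _.
  rewrite !mevalZ -cy2 mevalX_cut -cy1 mevalX_cut -mulrA -mevalM -mpolyXD.
  by rewrite addmC restrictD.
pose q a : {mpoly K[n]} :=
  \sum_(m <- msupp p | restrict P m == a) p@_m *: 'X_[restrict (predC P) m].
have q0 a : q a = 0.
  apply: (@standard_independent Y2) => [y2 Y2y2|m]; last first.
    move/msupp_sum_le => /flatten_mapP[m']; rewrite mem_filter => /andP[_ m'p].
    move/msuppZ_le; rewrite msuppX inE => /eqP ->.
    by have /andP[] := pS _ m'p.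
  have := congr1 (mcoeff a) (py0 _ Y2y2); rewrite mcoeff0 => <-.
  rewrite !raddf_sum /= big_mkcond; apply: eq_bigr => m _.
  rewrite mcoeffZ mcoeffX mevalZ; case: ifP; rewrite ?mulr0 ?mulr1 //.
apply/mpolyP => m; rewrite mcoeff0; apply/eqP; apply: contraT.
rewrite -mcoeff_msupp => mp.
have := congr1 (mcoeff (restrict (predC P) m)) (q0 (restrict P m)).
rewrite mcoeff0 raddf_sum /= big_mkcond (bigD1_seq m) ?msupp_uniq //= eqxx.
rewrite big1 => [|m' mm'].
  by rewrite mcoeffZ mcoeffX eqxx mulr1 addr0 => /eqP; rewrite mcoeff_eq0 mp.
case: eqP => // mP; rewrite mcoeffZ mcoeffX; case: eqP => [e|]; last by rewrite mulr0.
by case/eqP: mm'; rewrite -(restrictD P m') mP e restrictD.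
Qed.

(** Outside [S] every monomial leads a vanishing polynomial. Conversely, if some [u] in [S] led a
    vanishing [p], reducing the lower terms of [p] would leave a vanishing combination of monomials
    of [S] with nonzero coefficient at [u], against independence. *)
Theorem standard_product u : standard Y u = S u.
Proof.
have SY v : ~~ S v -> exists r, [/\ r != 0, vanishes Y r & mlead r = v].
  by rewrite negb_and => /orP[]; apply: nonstandard_factor => y /YE[].
apply/idP/idP => [/asboolP uS|Su].
  by apply: contraT => /SY[r [r0 rY ru]]; have := uS r r0 rY; rewrite ru eqxx.
apply/asboolP => p p0 pY; apply/eqP => pu.
pose p' := p - p@_u *: 'X_[u].
have pu0 : p@_u != 0 by rewrite -pu mleadc_eq0.
have p'u : p'@_u = 0 by rewrite mcoeffB mcoeffZ mcoeffX eqxx mulr1 subrr.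
have [q [qY qS q0]] := reduce p' SY.
have qu : q@_u = 0.
  apply: q0 => m mp'; rewrite lt_neqAle; apply/andP; split.
    by apply: contraTneq mp' => ->; rewrite -mcoeff_eq0 p'u.
  apply: le_trans (msupp_le_mlead mp') _; apply: le_trans (mleadB_le _ _) _.
  by rewrite leUx pu lexx mleadZ // mleadXm lexx.
have z : p@_u *: 'X_[u] + q = 0.
  apply: product_independent => [y Yy|m].
    have := qY y Yy; rewrite /p' !mevalB pY // sub0r mevalD => /eqP.
    by rewrite -opprD oppr_eq0 => /eqP.
  move/msuppD_le; rewrite mem_cat msuppMCX // inE => /orP[/eqP -> //|]; exact: qS.
have := congr1 (mcoeff u) z; rewrite mcoeffD mcoeffZ mcoeffX eqxx mulr1 qu mcoeff0.
by rewrite addr0 => /eqP; rewrite (negbTE pu0).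
Qed.

End Product.

(** The restriction of [p] to the line through 0 and [y]. Its coefficients are the values at [y] of
    the homogeneous components of [p], which links stability under scaling to homogeneity. *)
Definition ray p y : {poly K} := mmap polyC (fun i => y i *: 'X) p.

Lemma rayE p y :
  ray p y = \sum_(m <- msupp p) (p@_m * 'X_[m].@[y]) *: 'X^(mdeg m).
Proof.
apply: eq_bigr => m _; rewrite mevalX mul_polyC -scalerA; congr (_ *: _).
rewrite /mmap1 (eq_bigr (fun i => (y i ^+ m i) *: ('X ^+ m i : {poly K}))); last first.
  by move=> i _; rewrite exprZn.
rewrite scaler_prod; congr (_ *: _).
by rewrite mdegE expr_sum.
Qed.

Lemma rayM p q y : ray (p * q) y = ray p y * ray q y.
Proof. by rewrite /ray -rmorphM. Qed.

Lemma horner_ray p y s : (ray p y).[s] = p.@[fun i => s * y i].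
Proof.
rewrite rayE horner_sum [in RHS](mpolyE p) raddf_sum /=; apply: eq_bigr => m _.
rewrite hornerZ hornerXn mevalZ -mulrA; congr (_ * _); rewrite !mevalX mdegE.
rewrite expr_sum -big_split /=; apply: eq_bigr => i _.
by rewrite exprMn mulrC.
Qed.

Lemma ray_homog p e y : p \is e.-homog -> ray p y = p.@[y] *: 'X^e.
Proof.
move=> /dhomogP pe; rewrite rayE [in RHS](mpolyE p) raddf_sum /= scaler_suml.
rewrite big_seq [RHS]big_seq.
by apply: eq_bigr => m /pe mE; rewrite [mdeg m]mE mevalZ.
Qed.

Lemma coef_ray p y k : (ray p y)`_k = (pihomog mdeg k p).@[y].
Proof.
rewrite rayE coef_sum pihomogE raddf_sum /= [RHS]big_mkcond; apply: eq_bigr => m _.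
by rewrite coefZ coefXn eq_sym mevalZ; case: ifP; rewrite ?mulr1 ?mulr0.
Qed.

End StandardMonomials.

(** * Cones: homogeneity, linear subspaces, products *)

Section Cones.
Variables (K : closedFieldType) (n : nat).
Implicit Types (p q : {mpoly K[n]}) (u m : 'X_{1..n}) (y : 'I_n -> K).
Implicit Types (P : pred 'I_n) (Y : set ('I_n -> K)).

(** If [f] is not constant, [f + 1] has a root, and there [f] is -1. *)
Lemma closed_field_poly0 (f : {poly K}) : (forall s, f.[s] = 0) -> f = 0.
Proof.
move=> f0; apply/eqP; apply: contraT => fn0.
have sf : size f != 1%N.
  by apply/negP => /size_poly1P[c c0 fc]; move: (f0 0); rewrite fc hornerC => /eqP; rewrite (negbTE c0).
have s1 : size (f + 1) != 1%N.
  have f1 : (1 < size f)%N.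
    by rewrite ltn_neqAle eq_sym sf size_poly_gt0.
  by rewrite size_polyDl ?size_poly1.
have /closed_rootP[s /eqP] := s1.
by rewrite hornerD f0 hornerC add0r => /eqP; rewrite oner_eq0.
Qed.

Definition cone Y := Y (fun => 0) /\ forall s y, Y y -> Y (fun i => s * y i).

Lemma cone_ray Y p y : cone Y -> vanishes Y p -> Y y -> ray p y = 0.
Proof.
by move=> [_ Ys] pY Yy; apply: closed_field_poly0 => s; rewrite horner_ray pY //; apply: Ys.
Qed.

Lemma cone_pihomog Y p k : cone Y -> vanishes Y p -> vanishes Y (pihomog mdeg k p).
Proof. by move=> Yc pY y Yy; rewrite -coef_ray (cone_ray Yc pY Yy) coef0. Qed.

(** On each ray the product vanishes in the domain K[X], and the restriction of [h] is nonzero at 0.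
    So vanishing near the vertex is vanishing on the whole cone. *)
Lemma cone_cancel Y h p :
  cone Y -> h.@[fun => 0] != 0 -> vanishes Y (h * p) -> vanishes Y p.
Proof.
move=> Yc h0 hpY y Yy; have := cone_ray Yc hpY Yy; rewrite rayM => /eqP.
rewrite mulf_eq0 => /orP[/eqP/(congr1 (horner^~ 0))|/eqP/(congr1 (horner^~ 1))].
  rewrite horner_ray horner0 => /eqP; rewrite (_ : (fun i => 0 * y i) = fun => 0).
    by rewrite (negbTE h0).
  by apply/funext => i; rewrite mul0r.
rewrite horner_ray horner0 (_ : (fun i => 1 * y i) = y) //.
by apply/funext => i; rewrite mul1r.
Qed.

Lemma pihomog_supp p k m : m \in msupp (pihomog mdeg k p) -> m \in msupp p /\ mdeg m = k.
Proof.
move=> mp; have mk : mdeg m = k.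
  by apply/(dhomogP _ _ _ (pihomogP mdeg k p)).
split=> //; move: mp; rewrite pihomogE => /msupp_sum_le/flatten_mapP[m'].
rewrite mem_filter => /andP[_ m'p] /msuppZ_le; rewrite msuppX inE => /eqP -> //.
Qed.

Lemma mcoeff_pihomog p k m : (pihomog mdeg k p)@_m = if mdeg m == k then p@_m else 0.
Proof.
case: ifPn => mk; last by apply: dhomog_nemf_coeff (pihomogP _ _ _) mk.
rewrite pihomogE raddf_sum /= big_mkcond /=.
have [mp|mp] := boolP (m \in msupp p); last first.
  rewrite (memN_msupp_eq0 mp) big_seq big1 // => m' m'p.
  case: ifP => // _; rewrite mcoeffZ mcoeffX.
  by case: eqP => [e|]; [rewrite -e m'p in mp|rewrite mulr0].
rewrite (bigD1_seq m) ?msupp_uniq //= mk mcoeffZ mcoeffX eqxx mulr1 big1 ?addr0 //.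
by move=> m' /negbTE mm'; case: ifP => // _; rewrite mcoeffZ mcoeffX mm' mulr0.
Qed.

Lemma reduce_homog Y p k : cone Y -> p \is k.-homog ->
  exists2 q, vanishes Y (p - q) & forall m, m \in msupp q -> standard Y m /\ mdeg m = k.
Proof.
move=> Yc pk; have [q qY qS] := reduce_standard Y p.
exists (pihomog mdeg k q) => [|m /pihomog_supp[/qS mS mk]] //.
by rewrite -{1}(pihomog_dE pk) -raddfB; apply: cone_pihomog.
Qed.

Lemma standard0 Y : Y (fun => 0) -> standard Y 0%MM.
Proof.
move=> Y0; apply/asboolP => p p0 pY; apply/eqP => p00.
have pc : p = (p@_0%MM)%:MP.
  apply/mpolyP => m; rewrite mcoeffC; have [->|m0] := eqVneq m 0%MM.
    by rewrite mulr1.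
  rewrite mulr0 memN_msupp_eq0 //; apply/negP => /msupp_le_mlead.
  by rewrite p00 leNgt lt_neqAle eq_sym m0 le0m.
by move: (pY _ Y0); rewrite pc mevalC => z; move: p0; rewrite pc z eqxx.
Qed.

Lemma count_standard0 Y : Y (fun => 0) -> count_mons (standard Y) 0 = 1%N.
Proof. by move=> Y0; rewrite count_mons0 standard0. Qed.

(* The coordinate ring of a cone is reduced. *)
Lemma count_standard_eq0 Y k : cone Y -> count_mons (standard Y) k = 0%N ->
  forall j, (0 < j)%N -> count_mons (standard Y) j = 0%N.
Proof.
move=> Yc k0 j j0.
have nos m : standard Y m -> mdeg m = k -> False.
  move=> mS mk; have := mem_mons (standard Y) k m; rewrite mS mk eqxx.
  by rewrite (size0nil k0).
(* The power x_i^k reduces to a combination of standard monomials of degree k, of which there are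
   none; so it vanishes on [Y], and x_i with it. *)
have y0 y i : Y y -> y i = 0.
  move=> Yy; have Xk : 'X_[(U_(i) *+ k)%MM] \is [in K[n], k.-homog].
    by rewrite dhomogX /= mdegMn mdeg1 mul1n.
  have [q qY qS] := reduce_homog Yc Xk.
  have q0 : q = 0.
    apply/eqP; rewrite -msupp_eq0; case sq: (msupp q) => [//|m s].
    by have [/nos H /H] : standard Y m /\ mdeg m = k by apply: qS; rewrite sq mem_head.
  have := qY y Yy; rewrite q0 subr0 -mpolyXn rmorphXn /= mevalXU => /eqP.
  by rewrite expf_eq0 => /andP[_ /eqP].
rewrite (@count_monsE _ _ _ [::]) // => u; rewrite in_nil; apply/esym/negP.
move=> /andP[/eqP uj uS].
have [i ui] : exists i, u i != 0%N.
  apply: contrapT => noi; move: j0; rewrite -uj mdegE big1 // => i _.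
  by apply/eqP; apply: contrapT => /negP ui; apply: noi; exists i.
have /asboolP/(_ 'X_i (mpolyX_neq0 _ _)) : standard Y U_(i).
  by apply: standard_down_closed uS; rewrite lep1mP.
by rewrite mleadXm eqxx => /(_ _)/negP; apply=> // y Yy; rewrite mevalXU y0.
Qed.

Definition coord_subspace P : set ('I_n -> K) := [set y | cut P y = y].

Lemma restrict1E i u : restrict (pred1 i) u = u -> u = (U_(i) *+ mdeg u)%MM.
Proof.
move=> ui; have uE j : u j = if j == i then u j else 0%N by rewrite -{1}ui restrictE.
apply/mnmP => j; rewrite mulmnE mnm1E mdegE (bigD1 i) //= big1 => [|c ci].
  by rewrite uE [i == j]eq_sym; case: eqP => [->|]; rewrite ?mul0n // mul1n addn0.
by rewrite uE (negbTE ci).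
Qed.

(** On the i-th axis a polynomial becomes univariate, with [p@_u] as coefficient in degree [mdeg u];
    if it vanishes at all scalars this coefficient is 0. *)
Lemma standard_line i u :
  standard (coord_subspace (pred1 i)) u = (restrict (pred1 i) u == u).
Proof.
apply/idP/eqP => [|ui]; first exact: standard_cut.
apply/asboolP => p p0 pY; apply/eqP => pu.
pose y j : K := (j == i)%:R.
have cut_y : cut (pred1 i) y = y.
  by apply/funext => j; rewrite /cut /y /=; case: (j == i).
have ray0 : ray p y = 0.
  apply: closed_field_poly0 => s; rewrite horner_ray pY //.
  by apply/funext => j; rewrite /cut /y /=; case: (j == i); rewrite ?mulr0.
have : (ray p y)`_(mdeg u) = p@_u.
  rewrite coef_ray pihomogE raddf_sum /= big_mkcond (bigD1_seq u) ?msupp_uniq //=.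
    rewrite eqxx mevalZ big1 ?addr0 => [|m mu].
      by rewrite [in 'X_[u]](restrict1E ui) -mpolyXn rmorphXn /= mevalXU /y eqxx expr1n mulr1.
    case: eqP => // mdu; rewrite mevalZ -cut_y mevalX_cut0 ?mulr0 //.
    apply: contraNN mu => /eqP/restrict1E ->.
    by rewrite [X in _ == X](restrict1E ui) mdu.
  by rewrite -pu mlead_supp.
by rewrite ray0 coef0 => /esym/eqP; rewrite -pu mleadc_eq0 (negbTE p0).
Qed.

Lemma cut_idP P y : cut P y = y <-> forall i, ~~ P i -> y i = 0.
Proof.
split=> [<- i Pi|y0]; first by rewrite /cut (negbTE Pi).
by apply/funext => i; rewrite /cut; case: ifPn => // /y0.
Qed.

(** The subspace is built from its axes one at a time by [standard_product]. *)
Lemma standard_coord_subspace P u :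
  standard (coord_subspace P) u = (restrict P u == u).
Proof.
suff H (l : seq 'I_n) v : uniq l ->
    standard (coord_subspace (mem l)) v = (restrict (mem l) v == v).
  have PE : coord_subspace P = coord_subspace (mem (enum P)).
    apply/funext => y; apply/propext; rewrite /coord_subspace /= !cut_idP.
    by split=> y0 i; move: (y0 i); rewrite /= mem_enum.
  rewrite PE H ?enum_uniq // !restrict_eqP; apply: eq_forallb => i.
  by rewrite /= mem_enum.
elim: l v => [|i l IHl] v /=.
  move=> _; apply/idP/eqP => [|v0]; first exact: standard_cut.
  have -> : v = 0%MM by apply/mnmP => i; rewrite mnm0E -v0 restrictE.
  by apply: standard0; apply/cut_idP.
move=> /andP[il lu].
have li j : j \in l -> j != i by apply: contraTneq => ->.
rewrite (@standard_product _ _ (pred1 i) (coord_subspace (pred1 i))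
  (coord_subspace (mem l))) //; last 2 first.
- move=> y; rewrite /coord_subspace /= !cut_idP => y0 j /=.
  by rewrite negbK => /eqP ->; apply: y0.
- move=> y; rewrite /coord_subspace /= !cut_idP; split=> [y0|[_ y0] j].
    split=> j /=; rewrite /cut /=; first by move=> /negbTE ->.
    case: eqP => //= /eqP ji jl; apply: y0.
    by rewrite /= inE negb_or ji.
  rewrite /= inE negb_or => /andP[ji jl].
  by have := y0 j jl; rewrite /cut /= ji.
rewrite /prod_pred standard_line IHl // !restrict_eqP.
apply/andP/forallP => [[_ /forallP v0] j|v0].
  have := v0 j; rewrite !restrictE /= inE negb_or.
  by case: (j == i).
split; apply/forallP => j; rewrite restrictE /=; first by case: (j == i).
by have := v0 j; rewrite /= inE negb_or; case: eqP => //= _ _; rewrite implybT.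
Qed.

(* The Hilbert series of the coordinate ring of Y is Q / (1 - t)^r with       *)
(* Q(1) != 0; then Q(1) is the degree of its Hilbert polynomial.              *)
Definition has_mult Y (e : rat) : Prop := exists r Q,
  [/\ gen_fun r Q (fun k => (count_mons (standard Y) k)%:R), Q.[1] != 0 & e = Q.[1]].

Lemma has_mult_exists Y : Y (fun => 0) -> exists e, has_mult Y e.
Proof.
move=> Y0; have [r [Q gf]] := gen_fun_down_closed (standard_down_closed (Y := Y)).
have [r' [Q' [gf' Q1]]] := gen_fun_normalize gf (count_standard0 Y0).
by exists Q'.[1], r', Q'.
Qed.

Lemma has_mult_coord_subspace P : has_mult (coord_subspace P) 1.
Proof.
have [r gf] := gen_fun_restrict P; exists r, 1; rewrite hornerC oner_eq0; split=> //.
apply: eq_gen_fun gf => k; congr _%:R; apply: eq_count_mons => u.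
by rewrite standard_coord_subspace.
Qed.

Lemma has_mult_product P Y1 Y2 Y e1 e2 :
    (forall y, Y1 y -> cut P y = y) -> (forall y, Y2 y -> cut (predC P) y = y) ->
    (forall y, Y y <-> Y1 (cut P y) /\ Y2 (cut (predC P) y)) ->
  has_mult Y1 e1 -> has_mult Y2 e2 -> has_mult Y (e1 * e2).
Proof.
move=> Y1P Y2P YE [r1 [Q1 [gf1 Q11 ->]]] [r2 [Q2 [gf2 Q21 ->]]].
exists (r1 + r2)%N, (Q1 * Q2); rewrite hornerM mulf_neq0 //; split=> //.
apply: gen_fun_conv gf1 gf2 _ => k.
rewrite (eq_count_mons (standard_product Y1P Y2P YE)) count_mons_prod.
- by rewrite natr_sum; apply: eq_bigr => i _; rewrite natrM.
- by move=> u; apply: standard_cut.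
- by move=> u; apply: standard_cut.
Qed.

Lemma has_mult_hilbert_poly Y e : cone Y -> has_mult Y e -> exists (p : {poly rat}) N,
  hilbert_degree p = e /\
  forall k, (N <= k)%N -> p.[k%:R] = (count_mons (standard Y) k)%:R.
Proof.
move=> Yc [r [Q [gf Q1 ->]]]; apply: gen_fun_hilbert_degree gf Q1 _ _.
  by apply: count_standard0; case: Yc.
by move=> k; apply: count_standard_eq0.
Qed.

End Cones.

(** * Multiplicity of the vertex of a cone *)

Section Order.
Variables (K : fieldType) (n : nat).
Implicit Types (p q : {mpoly K[n]}).

(** Membership in the k-th power of the ideal of the origin. *)
Definition ord_ge k p := forall m, (mdeg m < k)%N -> p@_m = 0.

Lemma ord_ge_supp k p m : ord_ge k p -> m \in msupp p -> (k <= mdeg m)%N.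
Proof. by move=> pk; rewrite mcoeff_msupp leqNgt; apply: contraNN => /pk/eqP. Qed.

Lemma ord_geP k p : (forall m, m \in msupp p -> (k <= mdeg m)%N) -> ord_ge k p.
Proof.
by move=> pk m mk; apply: memN_msupp_eq0; apply/negP => /pk; rewrite leqNgt mk.
Qed.

Lemma ord_geD k p q : ord_ge k p -> ord_ge k q -> ord_ge k (p + q).
Proof. by move=> pk qk m mk; rewrite mcoeffD pk // qk // addr0. Qed.

Lemma ord_geN k p : ord_ge k p -> ord_ge k (- p).
Proof. by move=> pk m mk; rewrite mcoeffN pk // oppr0. Qed.

Lemma ord_geM k l p q : ord_ge k p -> ord_ge l q -> ord_ge (k + l) (p * q).
Proof.
move=> pk ql; apply: ord_geP => m /msuppM_le/allpairsP[[a b] /= [ap bq ->]].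
by rewrite mdegD leq_add // (ord_ge_supp pk, ord_ge_supp ql).
Qed.

Lemma meval_at0 p : p.@[fun => 0] = p@_0%MM.
Proof.
have [p' [p'E p'c]] := meval_cut pred0 p.
have := p'E (fun => 0); rewrite (_ : cut _ _ = fun => 0) => [<-|]; last first.
  by apply/funext.
have -> : p' = (p@_0%MM)%:MP; last by rewrite mevalC.
apply/mpolyP => m; rewrite p'c mcoeffC.
rewrite (_ : restrict pred0 m = 0%MM); last first.
  by apply/mnmP => i; rewrite !mnmE.
by have [->|m0] := eqVneq m 0%MM; rewrite ?mulr1 ?mulr0.
Qed.

Lemma ord_ge1 p : p.@[fun => 0] = 0 -> ord_ge 1 p.
Proof.
by move=> p0 m; rewrite ltnS leqn0 mdeg_eq0 => /eqP ->; rewrite -meval_at0.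
Qed.

Lemma ord_ge1_eval p : ord_ge 1 p -> p.@[fun => 0] = 0.
Proof. by move=> p1; rewrite meval_at0 p1 // mdeg0. Qed.

End Order.

(** * Uniqueness of the dimension of a quotient *)

Section QuotDim.
Variables (K : fieldType) (A : comPzRingType) (iota : {rmorphism K -> A}).

(** Uniqueness of coordinates modulo [W] makes the two change-of-basis matrices satisfy
    [M *m M' = 1%:M]; comparing ranks gives one inequality, and symmetry the other. *)
Lemma quot_dim_unique (V W : set A) r r' :
    (forall x y, W x -> W y -> W (x + y)) -> (forall c x, W x -> W (iota c * x)) ->
  quot_dim iota V W r -> quot_dim iota V W r' -> r = r'.
Proof.
move=> WD WZ; suff le s s' : quot_dim iota V W s -> quot_dim iota V W s' -> (s <= s')%N.
  by move=> h h'; apply/eqP; rewrite eqn_leq !le.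
move=> [b bV bE] [b' b'V b'E].
have Wsum (I : finType) (F : I -> A) : (forall i, W (F i)) -> W 0 -> W (\sum_i F i).
  by move=> WF W0; elim/big_ind: _.
have /choice[C CE] : forall i, exists c : 'rV[K]_s',
    W (b i - \sum_j iota (c 0 j) * b' j).
  by move=> i; have [c [cW _]] := b'E _ (bV i); exists c.
have /choice[C' C'E] : forall i, exists c : 'rV[K]_s,
    W (b' i - \sum_j iota (c 0 j) * b j).
  by move=> i; have [c [cW _]] := bE _ (b'V i); exists c.
pose M := \matrix_(i, j) C i 0 j; pose M' := \matrix_(i, j) C' i 0 j.
suff MM' : M *m M' = 1%:M.
  by have := mxrankM_maxl M M'; rewrite MM' mxrank1 => /leq_trans; apply; exact: rank_leq_col.
apply/row_matrixP => i.
have W0 : W 0 by have := WZ 0 _ (CE i); rewrite rmorph0 mul0r.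
have [c [cW cU]] := bE _ (bV i).
have <- : c = row i 1%:M.
  apply: cU; rewrite (_ : b i - _ = 0) //; apply/eqP; rewrite subr_eq0; apply/eqP.
  rewrite (bigD1 i) //= big1 => [|j ji].
    by rewrite !mxE eqxx rmorph1 mul1r addr0.
  by rewrite !mxE eq_sym (negbTE ji) rmorph0 mul0r.
apply/esym/cU.
have -> : b i - \sum_j iota (row i (M *m M') 0 j) * b j =
    (b i - \sum_j iota (C i 0 j) * b' j) +
    \sum_j iota (C i 0 j) * (b' j - \sum_k iota (C' j 0 k) * b k).
  rewrite -(subrKA (\sum_j iota (C i 0 j) * b' j)); congr (_ + _).
  under [RHS]eq_bigr do rewrite mulrBr; rewrite sumrB; congr (_ - _).
  under [LHS]eq_bigr do rewrite mxE mxE rmorph_sum mulr_suml.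
  rewrite exchange_big; apply: eq_bigr => j _; rewrite mulr_sumr.
  by apply: eq_bigr => k _; rewrite !mxE rmorphM mulrA.
by apply: WD => //; apply: Wsum => // j; apply: WZ.
Qed.

End QuotDim.

(** * The associated graded ring at the vertex of a cone *)

Section LocalAlgebra.
Variables (K : closedFieldType) (n : nat) (A : comPzRingType).
Variables (iota : {rmorphism K -> A}) (ev : {rmorphism {mpoly K[n]} -> A}).
Variable Y : set ('I_n -> K).
Hypothesis Yc : cone Y.
Hypothesis evC : forall c, ev c%:MP = iota c.
Hypothesis ev_eq0 : forall p, ev p = 0 <-> vanishes Y p.
Hypothesis ev_unit : forall h, h.@[fun => 0] != 0 -> exists z, ev h * z = 1.
Hypothesis ev_frac : forall a, exists g h, h.@[fun => 0] != 0 /\ a * ev h = ev g.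
Implicit Types (g h : {mpoly K[n]}) (a : A).

(** Fractions g / h with h(0) != 0 and g of order at least k, written without division; [ideal_powE]
    identifies them with m^k. *)
Definition frac_ord k a := exists g h,
  [/\ h.@[fun => 0] != 0, ord_ge k g & a * ev h = ev g].

Lemma frac_ordD k a a' : frac_ord k a -> frac_ord k a' -> frac_ord k (a + a').
Proof.
move=> [g [h [h0 gk e]]] [g' [h' [h0' gk' e']]].
exists (h' * g + h * g'), (h * h'); split.
- by rewrite mevalM mulf_neq0.
- by apply: ord_geD; rewrite -[k]add0n; apply: ord_geM.
- by rewrite !rmorphD !rmorphM /= -e -e'; ring.
Qed.

Lemma frac_ordM k l a a' : frac_ord k a -> frac_ord l a' -> frac_ord (k + l) (a * a').
Proof.
move=> [g [h [h0 gk e]]] [g' [h' [h0' gk' e']]].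
exists (g * g'), (h * h'); split; [by rewrite mevalM mulf_neq0|exact: ord_geM|].
by rewrite !rmorphM /= -e -e'; ring.
Qed.

Lemma frac_ord_ev k g : ord_ge k g -> frac_ord k (ev g).
Proof.
by move=> gk; exists g, 1; rewrite meval1 oner_eq0 rmorph1 mulr1.
Qed.

Lemma frac_ordZ k c a : frac_ord k a -> frac_ord k (iota c * a).
Proof. by rewrite -evC -[k in X in _ -> X]add0n; apply/frac_ordM/frac_ord_ev. Qed.

Lemma max_idealE a : max_ideal a <-> frac_ord 1 a.
Proof.
have [g [h [h0 e]]] := ev_frac a; split=> [am|[g' [h' [h0' gk' e']]] [b ab]].
  exists g, h; split=> //; apply: ord_ge1; apply/eqP; apply/negPn/negP => g0.
  have [z gz] := ev_unit g0; apply: am; exists (ev h * z).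
  by rewrite mulrA e.
have [g2 [h2 [h20 e2]]] := ev_frac b.
(* An inverse of [a] would make this difference vanish on [Y], in particular at the vertex, where
   [g'] is 0 and both denominators are not. *)
have : ev (h' * h2 - g' * g2) = 0.
  by rewrite rmorphB !rmorphM /= -e' -e2 mulrACA ab mul1r subrr.
move/ev_eq0/(_ _ Yc.1); rewrite mevalB !mevalM (ord_ge1_eval gk') mul0r subr0.
by move/eqP; rewrite mulf_eq0 (negbTE h0') (negbTE h20).
Qed.

Lemma ideal_powE k a : ideal_pow (@max_ideal A) k a <-> frac_ord k a.
Proof.
elim: k a => [|k IHk] a.
  split=> // _; have [g [h [h0 e]]] := ev_frac a.
  by exists g, h; split.
rewrite /ideal_pow iterS -/(ideal_pow _ _); split=> [[s sP ->]|].
  have fr0 : frac_ord k.+1 0.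
    by rewrite -(rmorph0 ev); apply: frac_ord_ev => m _; rewrite mcoeff0.
  rewrite big_seq; elim/big_ind: _ => // [x y|p /sP[/max_idealE p1 /IHk p2]].
    exact: frac_ordD.
  by rewrite -add1n; apply: frac_ordM.
move=> [g [h [h0 gk e]]]; have [z hz] := ev_unit h0.
(* Every monomial of [g] has degree above k, so one variable splits off as an element of m; the
   rest, together with the inverse [z] of the denominator, lies in m^k. *)
have /choice[F FP] : forall m, exists x : A * A, m \in msupp g ->
    [/\ frac_ord 1 x.1, frac_ord k x.2 & ev (g@_m *: 'X_[m]) * z = x.1 * x.2].
  move=> m; have [mg|] := boolP (m \in msupp g); last by exists (0, 0).
  have mk := ord_ge_supp gk mg.
  have [i mi] : exists i, m i != 0%N.
    apply: contrapT => noi; move: mk; rewrite mdegE big1 // => i _.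
    by apply/eqP; apply: contrapT => /negP mi; apply: noi; exists i.
  exists (ev 'X_i, ev (g@_m *: 'X_[m - U_(i)]) * z) => _ /=; split.
  - apply: frac_ord_ev; apply: ord_ge1; rewrite mevalXU //.
  - exists (g@_m *: 'X_[m - U_(i)]), h; split=> //.
      apply: ord_geP => m' /msuppZ_le; rewrite msuppX inE => /eqP ->.
      have : (U_(i) <= m)%MM by rewrite lep1mP.
      by move/submK/(congr1 (@mdeg n)); rewrite mdegD mdeg1; lia.
    by rewrite -mulrA [z * _]mulrC hz mulr1.
  - rewrite mulrA -rmorphM /= -scalerAr -mpolyXD addmC submK // lep1mP //.
exists [seq F m | m <- msupp g] => [x /mapP[m mg ->]|].
  by have [F1 F2 _] := FP m mg; split; [apply/max_idealE|apply/IHk].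
rewrite big_map big_seq (eq_bigr (fun m => ev (g@_m *: 'X_[m]) * z)); last first.
  by move=> m /FP[_ _ ->].
rewrite -big_seq -mulr_suml -rmorph_sum /= -mpolyE -e -mulrA hz mulr1 //.
Qed.

Definition lin_comb k (c : 'rV[K]_(count_mons (standard Y) k)) : {mpoly K[n]} :=
  \sum_i c 0 i *: 'X_[tnth (in_tuple (mons (standard Y) k)) i].

Lemma mcoeff_lin_comb k c i :
  (@lin_comb k c)@_(tnth (in_tuple (mons (standard Y) k)) i) = c 0 i.
Proof.
rewrite raddf_sum /= (bigD1 i) //= mcoeffZ mcoeffX eqxx mulr1 big1 ?addr0 // => j ji.
rewrite mcoeffZ mcoeffX; case: eqP => [|_]; last by rewrite mulr0.
have /tuple_uniqP inj : uniq (in_tuple (mons (standard Y) k)) by exact: mons_uniq.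
by move/inj => e; rewrite e eqxx in ji.
Qed.

Lemma lin_comb_supp k c m : m \in msupp (@lin_comb k c) -> standard Y m /\ mdeg m = k.
Proof.
move/msupp_sum_le/flatten_mapP => [i _] /msuppZ_le; rewrite msuppX inE => /eqP ->.
have := mem_tnth i (in_tuple (mons (standard Y) k)).
by rewrite mem_mons => /andP[/eqP].
Qed.

Lemma lin_combE k q : (forall m, m \in msupp q -> standard Y m /\ mdeg m = k) ->
  q = lin_comb (\row_i q@_(tnth (in_tuple (mons (standard Y) k)) i)).
Proof.
move=> qS; apply/mpolyP => m; have [ms|ms] := boolP (m \in mons (standard Y) k).
  by have /tnthP[i ->] : m \in in_tuple (mons (standard Y) k); rewrite ?mcoeff_lin_comb ?mxE.
rewrite !memN_msupp_eq0 //; apply: contraNN ms.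
  by case/lin_comb_supp => mS mk; rewrite mem_mons mk eqxx.
by case/qS => mS mk; rewrite mem_mons mk eqxx.
Qed.

(** If the form L equals g / h with g of order above k, then L h - g vanishes on [Y]. Its degree k
    coefficient along the ray of [y] is h(0) L(y), so L vanishes on [Y], and a combination of
    standard monomials doing so is 0. *)
Lemma lin_comb_free k c : frac_ord k.+1 (ev (@lin_comb k c)) -> c = 0.
Proof.
move=> [g [h [h0 gk e]]]; set L := lin_comb c in e *.
have L0 : L = 0.
  apply: (@standard_independent _ _ Y) => [y Yy|m /lin_comb_supp[] //].
  have /ev_eq0 z : ev (L * h - g) = 0 by rewrite rmorphB rmorphM /= e subrr.
  have rL : ray L y = L.@[y] *: 'X^k.
    by apply/ray_homog/dhomogP => m /lin_comb_supp[].
  have := congr1 (coefp k) (cone_ray Yc z Yy); rewrite /= coef0 /ray rmorphB /=.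
  rewrite -!/(ray _ _) rayM rL coefB -scalerAl coefZ coefXnM ltnn subnn.
  rewrite -horner_coef0 horner_ray (_ : (fun i => 0 * y i) = fun => 0); last first.
    by apply/funext => i; rewrite mul0r.
  rewrite coef_ray (_ : pihomog mdeg k g = 0) ?meval0 ?subr0 => [/eqP|].
    by rewrite mulf_eq0 (negbTE h0) orbF => /eqP.
  by apply/mpolyP => m; rewrite mcoeff_pihomog mcoeff0; case: eqP => // mk; rewrite gk ?mk.
by apply/rowP => i; rewrite mxE -mcoeff_lin_comb -/L L0 mcoeff0.
Qed.

Lemma ev_lin_comb k c : ev (@lin_comb k c) =
  \sum_i iota (c 0 i) * ev 'X_[tnth (in_tuple (mons (standard Y) k)) i].
Proof.
by rewrite rmorph_sum; apply: eq_bigr => i _; rewrite -mul_mpolyC rmorphM /= evC.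
Qed.

Lemma quot_dim_pow k : quot_dim iota (ideal_pow (@max_ideal A) k)
  (ideal_pow (@max_ideal A) k.+1) (count_mons (standard Y) k).
Proof.
exists (fun i => ev 'X_[tnth (in_tuple (mons (standard Y) k)) i]) => [i|x].
  apply/ideal_powE/frac_ord_ev/ord_geP => m; rewrite msuppX inE => /eqP ->.
  have := mem_tnth i (in_tuple (mons (standard Y) k)).
  by rewrite mem_mons => /andP[/eqP -> _].
move=> /ideal_powE[g [h [h0 gk e]]].
have [q qY qS] := reduce_homog Yc (pihomogP mdeg k g).
set gk' := pihomog _ _ _ in qY; set u := h.@[_] in h0.
have evq : ev q = ev gk'.
  by apply/esym/eqP; rewrite -subr_eq0 -rmorphB; apply/eqP/ev_eq0.
(* Modulo m^(k+1), g / h is the degree k component of g divided by u = h(0); [q] is the standard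
   form of that component. *)
pose L := u^-1 *: q.
have LS m : m \in msupp L -> standard Y m /\ mdeg m = k by move/msuppZ_le/qS.
set c := \row_i L@_(tnth (in_tuple (mons (standard Y) k)) i).
have cW : frac_ord k.+1 (x - ev (lin_comb c)).
  rewrite -lin_combE //.
  exists ((g - gk') - u^-1 *: ((h - u%:MP) * gk')), h; split=> //.
    apply: ord_geD.
      move=> m mk; rewrite mcoeffB mcoeff_pihomog; case: eqP => [_|/eqP mk'].
        by rewrite subrr.
      by rewrite subr0 gk // ltn_neqAle mk' -ltnS.
    apply: ord_geN; rewrite -mul_mpolyC -[k.+1]add0n; apply: ord_geM => //.
    rewrite -add1n; apply: ord_geM.
      by apply: ord_ge1; rewrite mevalB mevalC subrr.
    by apply: ord_geP => m /pihomog_supp[_ ->].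
  rewrite mulrBl e /L -!mul_mpolyC !rmorphB !rmorphM /= evq !rmorphB /= !evC.
  have : iota u^-1 * iota u = 1 by rewrite -rmorphM mulVf // rmorph1.
  move=> uu; rewrite mulrBl mulrBr [iota u^-1 * (iota u * _)]mulrA uu mul1r; ring.
exists c; split=> [|c' /ideal_powE]; first by apply/ideal_powE; rewrite -ev_lin_comb.
rewrite -ev_lin_comb => c'W; apply/eqP; rewrite -subr_eq0; apply/eqP/lin_comb_free.
have -> : ev (lin_comb (c - c')) =
    (x - ev (lin_comb c')) + iota (- 1) * (x - ev (lin_comb c)).
  rewrite rmorphN rmorph1 mulN1r opprB [RHS]addrC subrKA !ev_lin_comb -sumrB.
  by apply: eq_bigr => i _; rewrite !mxE rmorphB mulrBl.
by apply: frac_ordD c'W _; apply: frac_ordZ.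
Qed.

(** The [xget] in [multiplicity] has a unique candidate: dimensions determine the Hilbert function,
    and two polynomials that agree at all large integers are equal. *)
Theorem multiplicity_cone e : has_mult Y e -> multiplicity iota = e.
Proof.
move=> /(has_mult_hilbert_poly Yc)[p [N [<- pN]]].
apply: xget_unique => [|c [p' [h hE [N' p'N]] ->]].
  by exists p => //; exists (count_mons (standard Y)) => [k|]; [exact: quot_dim_pow|exists N].
have hh k : h k = count_mons (standard Y) k.
  apply: quot_dim_unique (hE k) (quot_dim_pow k) => [x y /ideal_powE xk /ideal_powE yk|c' x /ideal_powE xk].
    by apply/ideal_powE/frac_ordD.
  by apply/ideal_powE/frac_ordZ.
congr hilbert_degree; apply/eqP; rewrite -subr_eq0; apply: contraT => pp'.
pose rs : seq rat := [seq (N + N' + i)%:R | i <- seq.iota 0 (size (p' - p))].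
have := max_poly_roots pp' (rs := rs); rewrite size_map size_iota ltnn => -> //.
  apply/allP => _ /mapP[i _ ->]; rewrite /root hornerD hornerN pN ?p'N; try lia.
  by rewrite hh subrr.
by rewrite map_inj_uniq ?iota_uniq // => i j /eqP; rewrite eqr_nat => /eqP; lia.
Qed.

End LocalAlgebra.

(** * The chart of the Grassmannian at a coordinate point *)

Section RowSpan.
Variables (K : fieldType) (n : nat).

Definition lmul m (M : 'M[K]_(m, n)) : 'Hom('rV[K]_m, 'rV[K]_n) :=
  linfun (mulmxr M).

Lemma lmulE m (M : 'M[K]_(m, n)) u : lmul M u = u *m M.
Proof. by rewrite lfunE. Qed.

Definition rspan m (M : 'M[K]_(m, n)) : {vspace 'rV[K]_n} := limg (lmul M).

Lemma memv_rspan m (M : 'M[K]_(m, n)) v :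
  reflect (exists u, v = u *m M) (v \in rspan M).
Proof.
apply: (iffP memv_imgP) => [[u _ ->]|[u ->]]; exists u; rewrite ?lmulE ?memvf //.
Qed.

Lemma row_rspan m (M : 'M[K]_(m, n)) i : row i M \in rspan M.
Proof. by apply/memv_rspan; exists (delta_mx 0 i); rewrite -rowE. Qed.

Lemma rspan_factor m m' (M : 'M[K]_(m, n)) (N : 'M[K]_(m', n)) :
  (rspan M <= rspan N)%VS -> exists A, M = A *m N.
Proof.
move=> /subvP MN; have /choice[f fE] : forall i, exists u, row i M = u *m N.
  by move=> i; apply/memv_rspan/MN/row_rspan.
exists (\matrix_i f i); apply/row_matrixP => i.
by rewrite row_mul rowK.
Qed.

Lemma rspan_mull m (A : 'M[K]_m) (M : 'M[K]_(m, n)) :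
  A \in unitmx -> rspan (A *m M) = rspan M.
Proof.
move=> Au; apply/eqP; rewrite eqEsubv; apply/andP; split; apply/subvP => v.
  by move=> /memv_rspan[u ->]; apply/memv_rspan; exists (u *m A); rewrite mulmxA.
move=> /memv_rspan[u ->]; apply/memv_rspan; exists (u *m invmx A).
by rewrite mulmxA mulmxKV.
Qed.

Lemma rspan_mulr m (M : 'M[K]_(m, n)) (g : 'M[K]_n) :
  rspan (M *m g) = (lmul g @: rspan M)%VS.
Proof.
rewrite -limg_comp; apply/eqP; rewrite eqEsubv; apply/andP; split; apply/subvP => v.
  move=> /memv_rspan[u ->]; apply/memv_imgP; exists u; rewrite ?memvf //.
  by rewrite comp_lfunE !lmulE mulmxA.
move=> /memv_imgP[u _ ->]; apply/memv_rspan; exists u.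
by rewrite comp_lfunE !lmulE mulmxA.
Qed.

(** The common form of [flag] and [opp_flag], both of which are instances by conversion. *)
Definition axes_span (q : pred 'I_n) : {vspace 'rV[K]_n} :=
  <<[seq std K j | j : 'I_n <- enum 'I_n & q j]>>%VS.

Lemma memv_axes_span q (v : 'rV[K]_n) :
  reflect (forall j, ~~ q j -> v 0 j = 0) (v \in axes_span q).
Proof.
apply: (iffP idP) => [|v0].
  rewrite /axes_span -[X in <<X>>%VS]/(tval (in_tuple _)) => /coord_span -> j qj; rewrite summxE big1 // => i _; rewrite mxE.
  suff -> : [seq std K j | j : 'I_n <- enum 'I_n & q j]`_i 0 j = 0 by rewrite mulr0.
  have : [seq std K j | j : 'I_n <- enum 'I_n & q j]`_i \in
         [seq std K j | j : 'I_n <- enum 'I_n & q j] by apply: mem_nth.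
  move=> /mapP[k]; rewrite mem_filter => /andP[qk _] ->.
  by rewrite mxE eqxx /=; case: eqP => // jk; rewrite jk qk in qj.
rewrite (row_sum_delta v); apply: rpred_sum => j _.
have [qj|/v0 ->] := boolP (q j); last by rewrite scale0r mem0v.
by apply/rpredZ/memv_span/map_f; rewrite mem_filter qj mem_enum.
Qed.

Lemma unitmx_lker0 (g : 'M[K]_n) : g \in unitmx -> lker (lmul g) == 0%VS.
Proof.
move=> gu; apply/lker0P => u v; rewrite !lmulE => /(congr1 (mulmxr (invmx g))) /=.
by rewrite !mulmxK.
Qed.

Lemma axes_span_stable (g : 'M[K]_n) (q : pred 'I_n) : g \in unitmx ->
    (forall i j, q i -> ~~ q j -> g i j = 0) ->
  (lmul g @: axes_span q)%VS = axes_span q.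
Proof.
move=> gu gq; apply/eqP; rewrite eqEdim limg_dim_eq ?leqnn ?andbT; last first.
  by rewrite (eqP (unitmx_lker0 gu)) capv0.
apply/subvP => _ /memv_imgP[v /memv_axes_span v0 ->]; apply/memv_axes_span => j qj.
rewrite lmulE mxE big1 // => i _; have [qi|/v0 ->] := boolP (q i); last by rewrite mul0r.
by rewrite gq // mulr0.
Qed.

Lemma dim_cap_stable (g : 'M[K]_n) (q : pred 'I_n) m (M : 'M[K]_(m, n)) : g \in unitmx ->
    (forall i j, q i -> ~~ q j -> g i j = 0) ->
  \dim (rspan (M *m g) :&: axes_span q) = \dim (rspan M :&: axes_span q).
Proof.
move=> gu gq; rewrite rspan_mulr -{1}(axes_span_stable gu gq).
rewrite -lker0_img_cap ?unitmx_lker0 // limg_dim_eq //.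
by rewrite (eqP (unitmx_lker0 gu)) capv0.
Qed.

End RowSpan.

(** * Pluecker coordinates as maximal minors *)

Section PluckerCoordinates.
Variables (K : fieldType) (d n : nat).
Implicit Types (U : grass K d n) (f : 'I_d -> 'I_n).

Lemma pevalD (g h : {mpoly K[#|{: idx d n}|]}) U : peval (g + h) U = peval g U + peval h U.
Proof. exact: mevalD. Qed.

Lemma pevalZ c (g : {mpoly K[#|{: idx d n}|]}) U : peval (c *: g) U = c * peval g U.
Proof. exact: mevalZ. Qed.

Lemma pevalXn i e U : peval ('X_(enum_rank i) ^+ e) U = plucker U i ^+ e.
Proof. by rewrite /peval rmorphXn /= mevalXU enum_rankK. Qed.

Lemma homogXn (i : idx d n) e : ('X_(enum_rank i) ^+ e : {mpoly K[#|{: idx d n}|]}) \is e.-homog.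
Proof. by rewrite -[X in X.-homog]mul1n; apply: dhomogMn; rewrite dhomogX /= mdeg1. Qed.

Definition basis_mx U : 'M[K]_(d, n) := \matrix_(a, j) (vbasis (val U))`_a 0 j.

Lemma row_basis_mx U a : row a (basis_mx U) = (vbasis (val U))`_a.
Proof. by apply/rowP => j; rewrite !mxE. Qed.

Lemma rspan_basis_mx U : rspan (basis_mx U) = val U.
Proof.
have dU : \dim (val U) = d := eqP (valP U).
apply/eqP; rewrite eqEsubv; apply/andP; split.
  apply/subvP => _ /memv_rspan[u ->]; rewrite mulmx_sum_row.
  apply: rpred_sum => a _; rewrite row_basis_mx; apply/rpredZ/vbasis_mem/mem_nth.
  by rewrite size_tuple [X in (_ < X)%N]dU.
rewrite -{1}(span_basis (vbasisP (val U))); apply/span_subvP => v /(nthP 0)[a].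
rewrite size_tuple => aU <-; have ad : (a < d)%N by rewrite -dU.
by rewrite -(row_basis_mx U (Ordinal ad)) row_rspan.
Qed.

Definition minor f (M : 'M[K]_(d, n)) : K := \det (colsub f M).

Lemma colsub_mul m f (A : 'M[K]_(m, d)) (M : 'M[K]_(d, n)) : colsub f (A *m M) = A *m colsub f M.
Proof. by apply/matrixP => i j; rewrite !mxE; apply: eq_bigr => k _; rewrite !mxE. Qed.

Lemma minor_mul f (A : 'M[K]_d) M : minor f (A *m M) = \det A * minor f M.
Proof. by rewrite /minor colsub_mul det_mulmx. Qed.

Lemma pluckerE U i : plucker U i = minor (pos i) (basis_mx U).
Proof. by congr determinant; apply/matrixP => a b; rewrite !mxE. Qed.

Lemma sort_injective f : injective f ->
  exists (i : idx d n) (s : 'S_d), forall b, f b = pos i (s b).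
Proof.
move=> f_inj; pose r : rel 'I_n := fun a b => (a <= b)%N.
have rt : total r by move=> a b; apply: leq_total.
have rtr : transitive r by move=> b a c; apply: leq_trans.
pose F := [tuple f b | b < d]; pose T := [tuple of sort r F].
have uT : uniq T by rewrite sort_uniq; apply/tuple_uniqP => a b; rewrite !tnth_mktuple => /f_inj.
have sT : sorted (fun a b : 'I_n => (a < b)%N) T.
  have := sort_sorted rt F; rewrite -/(tval T).
  move=> sr; have : sorted ltn [seq val x | x <- T].
    rewrite ltn_sorted_uniq_leq map_inj_uniq ?uT; last exact: val_inj.
    by rewrite sorted_map.
  by rewrite sorted_map.
have /tuple_permP[s sE] : perm_eq F T by rewrite perm_sym perm_sort.
exists (exist _ T sT), s => b.
have -> : f b = tnth F b by rewrite tnth_mktuple.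
by rewrite (val_inj sE : F = _) tnth_mktuple.
Qed.

(** Columns in arbitrary order are allowed, since replacing one column of [tau] breaks the ordering:
    sorting costs a sign, and a repeated column gives 0. *)
Lemma minor_linear f : exists2 g : {mpoly K[#|{: idx d n}|]},
  g \is 1.-homog & forall U, peval g U = minor f (basis_mx U).
Proof.
have [/injectiveP f_inj|/injectivePn[a [b ab fab]]] := boolP (injectiveb f).
  have [i [s fE]] := sort_injective f_inj.
  exists ((-1) ^+ s *: 'X_(enum_rank i)) => [|U].
    by apply: dhomogZ; rewrite dhomogX /= mdeg1.
  have fC : colsub f (basis_mx U) = col_perm s (colsub (pos i) (basis_mx U)).
    by apply/matrixP => a b; rewrite !mxE fE.
  rewrite /peval mevalZ mevalXU enum_rankK pluckerE /minor fC col_permE.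
  by rewrite det_mulmx det_perm odd_permV mulrC.
exists 0 => [|U]; first exact: dhomog0.
rewrite /peval meval0 /minor -det_tr (determinant_alternate ab) // => k.
by rewrite !mxE fab.
Qed.

End PluckerCoordinates.

(** * Affine coordinates and passage to and from homogeneous polynomials *)

Section Chart.
Variables (K : fieldType) (d n : nat) (tau : idx d n).
Local Notation N := #|{: 'I_d * 'I_n}|.
Implicit Types (U : grass K d n) (y : 'I_N -> K) (i : idx d n).
Implicit Types (G : {mpoly K[N]}).

Definition axis_mx : 'M[K]_(d, n) := \matrix_(t, j) (j == pos tau t)%:R.

Definition mx_of y : 'M[K]_(d, n) := \matrix_(t, j) y (enum_rank (t, j)).

Definition tau_free y := forall t b, mx_of y t (pos tau b) = 0.

Lemma tau_free_colsub y : tau_free y -> colsub (pos tau) (axis_mx + mx_of y) = 1%:M.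
Proof.
move=> y0; apply/matrixP => t b; have := y0 t b; rewrite !mxE => ->.
by rewrite addr0 (inj_eq (@pos_inj _ _ tau)) eq_sym.
Qed.

Definition normal_mx U : 'M[K]_(d, n) :=
  invmx (colsub (pos tau) (basis_mx U)) *m basis_mx U.

(* Redundant: the coordinates in the columns of tau vanish on the chart.      *)
Definition coords U : 'I_N -> K :=
  fun k => (normal_mx U - axis_mx) (enum_val k).1 (enum_val k).2.

Lemma mx_of_coords U : axis_mx + mx_of (coords U) = normal_mx U.
Proof. by apply/matrixP => t j; rewrite !mxE /coords enum_rankK !mxE addrC subrK. Qed.

Lemma tau_unit U : plucker U tau != 0 -> colsub (pos tau) (basis_mx U) \in unitmx.
Proof. by rewrite pluckerE unitmxE unitfE. Qed.

Lemma colsub_normal_mx U : plucker U tau != 0 -> colsub (pos tau) (normal_mx U) = 1%:M.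
Proof. by move=> /tau_unit pU; rewrite /normal_mx colsub_mul mulVmx. Qed.

Lemma tau_free_coords U : plucker U tau != 0 -> tau_free (coords U).
Proof.
move=> /colsub_normal_mx; rewrite -mx_of_coords => /matrixP e t b.
have := e t b; rewrite !mxE (inj_eq (@pos_inj _ _ tau)) [b == t]eq_sym.
by rewrite -[X in _ = X]addr0 => /addrI.
Qed.

Lemma rspan_coords U : plucker U tau != 0 -> rspan (axis_mx + mx_of (coords U)) = val U.
Proof.
by move=> /tau_unit pU; rewrite mx_of_coords rspan_mull ?unitmx_inv // rspan_basis_mx.
Qed.

Lemma chart_pt_coords y U : tau_free y -> val U = rspan (axis_mx + mx_of y) ->
  plucker U tau != 0 /\ coords U = y.
Proof.
move=> /tau_free_colsub y1 UE; set M := axis_mx + _ in y1 UE.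
have [A BA] : exists A, basis_mx U = A *m M.
  by apply: rspan_factor; rewrite rspan_basis_mx UE.
have [A' MA] : exists A', M = A' *m basis_mx U.
  by apply: rspan_factor; rewrite rspan_basis_mx UE.
have AE : colsub (pos tau) (basis_mx U) = A by rewrite BA colsub_mul y1 mulmx1.
have AA : A' *m A = 1%:M by rewrite -AE -colsub_mul -MA.
have Au : A \in unitmx by have [] := mulmx1_unit AA.
split; first by rewrite pluckerE /minor AE -unitfE -unitmxE.
apply/funext => k; rewrite /coords /normal_mx AE BA mulKmx // /M addrC addKr mxE.
by rewrite -surjective_pairing enum_valK.
Qed.

Lemma chart_pt y : tau_free y ->
  exists U, val U = rspan (axis_mx + mx_of y).
Proof.
move=> /tau_free_colsub y1; set M := axis_mx + _ in y1 *.
suff dM : \dim (rspan M) == d by exists (Sub (rspan M) dM).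
rewrite /rspan limg_dim_eq; first by rewrite dimvf /dim /= mul1n.
apply/eqP; rewrite capfv -subv0; apply/subvP => u; rewrite memv_ker lmulE memv0 => /eqP uM.
by rewrite -[u]mulmx1 -y1 -colsub_mul uM; apply/eqP/matrixP => a b; rewrite !mxE.
Qed.

Lemma plucker_normal U i : plucker U tau != 0 ->
  plucker U i = plucker U tau * minor (pos i) (normal_mx U).
Proof.
move=> pU; rewrite !pluckerE -minor_mul /normal_mx mulKVmx //; exact: tau_unit.
Qed.

Definition minor_poly i : {mpoly K[N]} := \det (\matrix_(a, b)
  (((pos i b == pos tau a)%:R)%:MP + 'X_(enum_rank (a, pos i b)))).

Lemma minor_polyE U i : (minor_poly i).@[coords U] = minor (pos i) (normal_mx U).
Proof.
rewrite /minor_poly -det_map_mx /minor -mx_of_coords; congr determinant.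
by apply/matrixP => a b; rewrite !mxE /= mevalD mevalC mevalXU.
Qed.

(** On the chart each Pluecker coordinate is p_tau times a minor of the normalised matrix, hence
    p_tau times a polynomial in the affine coordinates; homogeneity pulls out p_tau^e. *)
Lemma homog_dehomog (g : {mpoly K[#|{: idx d n}|]}) e : g \is e.-homog ->
  exists G, forall U, plucker U tau != 0 ->
    peval g U = plucker U tau ^+ e * G.@[coords U].
Proof.
move=> ge; exists (g \mPo [tuple minor_poly (enum_val k) | k < #|{: idx d n}|]) => U pU.
rewrite comp_mpoly_meval /peval.
set v := (fun k => (tnth _ k).@[_]).
have -> : (fun k => plucker U (enum_val k)) = (fun k => plucker U tau * v k).
  by apply/funext => k; rewrite /v tnth_mktuple minor_polyE plucker_normal.
by rewrite -horner_ray (ray_homog _ ge) hornerZ hornerXn mulrC.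
Qed.

Definition homogenizable G := exists e (g : {mpoly K[#|{: idx d n}|]}), g \is e.-homog /\
  forall U, plucker U tau != 0 -> peval g U = plucker U tau ^+ e * G.@[coords U].

Lemma homogenizableM G G' : homogenizable G -> homogenizable G' -> homogenizable (G * G').
Proof.
move=> [e [g [ge gE]]] [e' [g' [ge' gE']]]; exists (e + e')%N, (g * g'); split.
  exact: dhomogM.
by move=> U pU; rewrite pevalM gE // gE' // mevalM exprD; ring.
Qed.

Local Notation tau_var := ('X_(enum_rank tau) : {mpoly K[#|{: idx d n}|]}).

Lemma homogenizableD G G' : homogenizable G -> homogenizable G' -> homogenizable (G + G').
Proof.
move=> [e [g [ge gE]]] [e' [g' [ge' gE']]].
(* Powers of p_tau bring the two summands to the same degree. *)
exists (e + e')%N, (g * tau_var ^+ e' + tau_var ^+ e * g'); split.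
  by apply: dhomogD; apply: dhomogM => //; apply: homogXn.
move=> U pU; rewrite pevalD !pevalM gE // gE' // !pevalXn.
by rewrite mevalD exprD; ring.
Qed.

Lemma homogenizableC c : homogenizable c%:MP.
Proof.
exists 0%N, c%:MP; split=> [|U _]; last by rewrite pevalC mevalC mul1r.
by rewrite -[c%:MP]mulr1 mul_mpolyC dhomogZ // dhomog1.
Qed.

(** The selected columns form the identity matrix with column [t] replaced, so expansion along row
    [t] leaves one entry. This exhibits an affine coordinate as a ratio of minors. *)
Lemma minor_normal_entry U t j : plucker U tau != 0 ->
  minor (fun b => if b == t then j else pos tau b) (normal_mx U) = normal_mx U t j.
Proof.
move=> /colsub_normal_mx /matrixP N1; rewrite /minor.
pose f b := if b == t then j else pos tau b; rewrite -/f.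
have NE a b : colsub f (normal_mx U) a b = if b == t then normal_mx U a j else (a == b)%:R.
  by rewrite mxE /f; case: eqP => // _; have := N1 a b; rewrite !mxE.
rewrite (expand_det_row _ t) (bigD1 t) //= big1 ?addr0 => [|b bt]; last first.
  by rewrite NE (negbTE bt) eq_sym (negbTE bt) mul0r.
rewrite NE eqxx /cofactor -signr_odd addnn odd_double expr0 mul1r.
have -> : row' t (col' t (colsub f (normal_mx U))) = 1%:M.
  apply/matrixP => a b; rewrite mxE [LHS]mxE NE !mxE.
  by rewrite eq_sym (negbTE (neq_lift _ _)) (inj_eq lift_inj).
by rewrite det1 mulr1.
Qed.

Lemma homogenizableX k : homogenizable 'X_k.
Proof.
pose t := (enum_val k).1; pose j := (enum_val k).2.
have [g g1 gE] := minor_linear K (fun b => if b == t then j else pos tau b).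
exists 1%N, (g - (axis_mx t j) *: tau_var); split.
  apply: rpredB => //; apply: rpredZ; rewrite -[tau_var]expr1; exact: homogXn.
move=> U pU; rewrite pevalB gE pevalZ.
rewrite -[tau_var]expr1 pevalXn !expr1 mevalXU.
have -> : coords U k = normal_mx U t j - axis_mx t j.
  by rewrite /coords [LHS]mxE; congr (_ + _); rewrite mxE.
have -> : minor (fun b => if b == t then j else pos tau b) (basis_mx U) =
    plucker U tau * normal_mx U t j.
  rewrite -minor_normal_entry // pluckerE /normal_mx -minor_mul mulKVmx //.
  exact: tau_unit.
by ring.
Qed.

Lemma homogenizable_all G : homogenizable G.
Proof.
have H1 : homogenizable 1 by exact: homogenizableC.
rewrite [G]mpolyE; elim/big_ind: _ => [||m _]; last 1 first.
- rewrite -mul_mpolyC; apply: homogenizableM (homogenizableC _) _.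
  rewrite mpolyXE_id; elim/big_ind: _ => // [|i _]; first exact: homogenizableM.
  elim: (m i) => [|e IHe]; first by rewrite expr0.
  by rewrite exprS; apply: homogenizableM (homogenizableX _) IHe.
- exact: (homogenizableC 0).
- exact: homogenizableD.
Qed.

End Chart.

Local Open Scope quotient_scope.

(** * The local ring in chart coordinates *)

Section LocalRingChart.
Variables (K : closedFieldType) (d n : nat) (tau : idx d n).
Variable X : {pred grass K d n}.
Local Notation N := #|{: 'I_d * 'I_n}|.
Local Notation P := (coord_pt K tau).
Local Notation A := (local_ring X P).
Implicit Types (U : grass K d n) (G H : {mpoly K[N]}).

Lemma coord_pt_chart : plucker P tau != 0 /\ coords tau P = fun => 0.
Proof.
apply: chart_pt_coords => [t b|]; first by rewrite mxE.
rewrite (_ : mx_of _ = 0) ?addr0; last by apply/matrixP => t j; rewrite !mxE.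
have rowE t : row t (axis_mx K tau) = std K (pos tau t).
  by apply/rowP => j; rewrite !mxE eqxx.
apply/eqP; rewrite eqEsubv; apply/andP; split.
  apply/span_subvP => _ /mapP[t _ ->]; rewrite -rowE; exact: row_rspan.
apply/subvP => _ /memv_rspan[u ->]; rewrite mulmx_sum_row; apply: rpred_sum => t _.
rewrite rowE; apply/rpredZ/memv_span/mapP; exists t => //; exact: mem_enum.
Qed.

Lemma coord_pt_neq0 : plucker P tau != 0. Proof. by case: coord_pt_chart. Qed.
Lemma coords_pt : coords tau P = fun => 0. Proof. by case: coord_pt_chart. Qed.

Lemma znear_chart (S : set (grass K d n)) : znear P S <->
  exists2 H, H.@[fun => 0] != 0 &
    forall U, plucker U tau != 0 -> H.@[coords tau U] != 0 -> S U.
Proof.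
split=> [[e [h [he hP hS]]]|[H H0 HS]].
  have [H HE] := homog_dehomog tau he; exists H => [|U pU HU].
    by move: hP; rewrite HE ?coord_pt_neq0 // coords_pt mulf_eq0 negb_or => /andP[].
  by apply: hS; rewrite HE // mulf_neq0 // expf_neq0.
have [e [h [he hE]]] := homogenizable_all tau H.
(* The extra factor p_tau confines the neighbourhood to the chart. *)
exists (1 + e)%N, ('X_(enum_rank tau) ^+ 1 * h); split.
- by apply: dhomogM => //; apply: homogXn.
- rewrite pevalM hE ?coord_pt_neq0 // coords_pt pevalXn.
  by rewrite !mulf_neq0 ?expf_neq0 ?coord_pt_neq0.
- move=> U; rewrite pevalM pevalXn expr1 mulf_eq0 negb_or.
  move=> /andP[pU]; rewrite hE // mulf_eq0 negb_or => /andP[_ HU]; exact: HS.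
Qed.

Lemma regular_coords G : regular_at X P (fun U => G.@[coords tau U]).
Proof.
have [e [g [ge gE]]] := homogenizable_all tau G.
exists e, g, ('X_(enum_rank tau) ^+ e); split=> //; first exact: homogXn.
apply/znear_chart; exists 1 => [|U pU _ _]; first by rewrite meval1 oner_eq0.
rewrite pevalXn expf_neq0 // gE //.
by rewrite mulrC mulKf // expf_neq0.
Qed.

Definition reg_coords G : reg X P :=
  Sub (fun U => G.@[coords tau U]) (asboolT (regular_coords G)).

Definition germ_coords G : A := germ (reg_coords G).

Fact germ_coords_zmod : zmod_morphism germ_coords.
Proof.
move=> G G'; rewrite /germ_coords -[RHS](raddfB (\pi_(Quotient.quot (@vanish_near _ _ _ X P)))).
congr germ; apply: val_inj; rewrite rmorphB; apply/funext => U.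
by rewrite /= mevalB.
Qed.

Fact germ_coords_monoid : monoid_morphism germ_coords.
Proof.
split=> [|G G'].
  by congr germ; apply: val_inj; rewrite rmorph1; apply/funext => U; rewrite /= meval1.
rewrite /germ_coords -[RHS]germM; congr germ; apply: val_inj; rewrite rmorphM.
by apply/funext => U; rewrite /= mevalM.
Qed.

HB.instance Definition _ :=
  GRing.isZmodMorphism.Build {mpoly K[N]} A germ_coords germ_coords_zmod.
HB.instance Definition _ :=
  GRing.isMonoidMorphism.Build {mpoly K[N]} A germ_coords germ_coords_monoid.

Definition chart_image : set ('I_N -> K) :=
  [set y | exists U, [/\ U \in X, plucker U tau != 0 & coords tau U = y]].

Hypothesis PX : P \in X.
Hypothesis Xc : cone chart_image.

Lemma germ_eq0 (f : reg X P) : germ f = 0 <-> exists2 H, H.@[fun => 0] != 0 &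
  forall U, U \in X -> plucker U tau != 0 -> H.@[coords tau U] != 0 -> val f U = 0.
Proof.
have -> : germ f = 0 <-> f \in @vanish_near _ _ _ X P.
  have <- : germ (0 : reg X P) = 0 by exact: raddf0.
  by rewrite germ_eq subr0.
have vE : (f \in @vanish_near _ _ _ X P) <-> znear P [set U | U \in X -> val f U = 0].
  by split=> [/asboolP|?]; [|apply/asboolP].
rewrite vE znear_chart; split=> [[H H0 HS]|[H H0 HS]]; exists H => //.
  by move=> U UX pU HU; apply: HS.
by move=> U pU HU UX; apply: HS.
Qed.

(** The affine coordinates present the local ring as that of the cone [chart_image] at its vertex.
    The kernel of [germ_coords] is the ideal of the whole cone by [cone_cancel]; units and fractions
    come from homogenising numerators and denominators. *)
Theorem mult_at_chart e : has_mult chart_image e -> mult_at X P = e.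
Proof.
apply: (multiplicity_cone (ev := germ_coords)) => //.
- move=> c; congr germ; apply: val_inj; apply/funext => U; rewrite /= mevalC //.
- move=> G; rewrite germ_eq0; split=> [[H H0 HG]|GY]; last first.
    exists 1; rewrite ?meval1 ?oner_eq0 // => U UX pU _.
    by apply: GY; exists U.
  apply: (cone_cancel Xc H0) => _ [U [UX pU <-]]; rewrite mevalM.
  have [->|HU] := eqVneq H.@[coords tau U] 0; first by rewrite mul0r.
  by rewrite [X in _ * X](HG U) // mulr0.
- move=> H H0; have [e0 [h [he hE]]] := homogenizable_all tau H.
  have Hr : regular_at X P (fun U => (H.@[coords tau U])^-1).
    exists e0, ('X_(enum_rank tau) ^+ e0), h; split=> //; first exact: homogXn.
    apply/znear_chart; exists H => // U pU HU _.
    rewrite hE // pevalXn mulf_neq0 ?expf_neq0 //.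
    by split=> //; rewrite invfM mulrA mulfV ?mul1r // expf_neq0.
  exists (germ (Sub (fun U => (H.@[coords tau U])^-1) (asboolT Hr) : reg X P)).
  rewrite -[RHS]/(germ 1) /germ_coords -[LHS]germM.
  apply/eqP; rewrite -subr_eq0 -[germ _ - _](raddfB (\pi_(Quotient.quot (@vanish_near _ _ _ X P)))).
  apply/eqP/germ_eq0; exists H => // U UX pU HU.
  rewrite rmorphB rmorphM rmorph1 /=.
  by rewrite !fctE mulfV // subrr.
- move=> a; have [f ->] := germ_repr a.
  have /asboolP[e0 [g [h [ge he nf]]]] := valP f.
  have [G GE] := homog_dehomog tau ge; have [H HE] := homog_dehomog tau he.
  have [Q Q0 QS] := (znear_chart _).1 nf.
  exists G, H; split.
    have [|hP _] := QS P coord_pt_neq0 _ PX; first by rewrite coords_pt.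
    move: hP; rewrite HE ?coord_pt_neq0 // coords_pt mulf_eq0 negb_or => /andP[] //.
  apply/eqP; rewrite -subr_eq0 /germ_coords -[_ * _]germM.
  rewrite -[germ _ - _](raddfB (\pi_(Quotient.quot (@vanish_near _ _ _ X P)))).
  apply/eqP/germ_eq0; exists Q => // U UX pU QU.
  have [hU fU] := QS U pU QU UX.
  rewrite rmorphB rmorphM /= !fctE fU GE // HE //.
  have pe : plucker U tau ^+ e0 != 0 by rewrite expf_neq0.
  have HU : H.@[coords tau U] != 0 by apply: contraNneq hU => z; rewrite HE // z mulr0.
  by field; rewrite pe HU.
Qed.

End LocalRingChart.

(** * Schubert conditions in the chart *)

Section SchubertConditions.
Variables (K : closedFieldType) (d n : nat) (tau : idx d n).
Local Notation N := #|{: 'I_d * 'I_n}|.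
Local Notation P := (coord_pt K tau).
Implicit Types (y : 'I_N -> K) (V : {vspace 'rV[K]_n}) (q : pred 'I_n).

Local Notation row_of k := (pos tau (enum_val k).1).
Local Notation col_of k := ((enum_val k).2).

Definition meets (q : 'I_d -> pred 'I_n) V : bool :=
  [forall t : 'I_d, (t.+1 <= \dim (V :&: axes_span K (q t)))%N].

Definition chart_cond (q : 'I_d -> pred 'I_n) : set ('I_N -> K) :=
  [set y | tau_free tau y /\ meets q (rspan (axis_mx K tau + mx_of y))].

Lemma meets_stable (q : 'I_d -> pred 'I_n) (g : 'M[K]_n) m (M : 'M[K]_(m, n)) :
    g \in unitmx -> (forall t i j, q t i -> ~~ q t j -> g i j = 0) ->
  meets q (rspan (M *m g)) = meets q (rspan M).
Proof.
move=> gu gq; apply: eq_forallb => t; rewrite dim_cap_stable // => i j; exact: gq.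
Qed.

Lemma axis_trmx : axis_mx K tau *m (axis_mx K tau)^T = 1%:M.
Proof.
apply/matrixP => a b; rewrite !mxE (bigD1 (pos tau a)) //= big1 => [|j ja].
  by rewrite !mxE eqxx mul1r addr0 (inj_eq (@pos_inj _ _ tau)).
by rewrite !mxE (negbTE ja) mul0r.
Qed.

Lemma tau_free_trmx y : tau_free tau y -> mx_of y *m (axis_mx K tau)^T = 0.
Proof.
move=> y0; apply/matrixP => a b; rewrite !mxE big1 // => j _; rewrite !mxE.
case: eqP => [->|]; rewrite ?mulr0 // mulr1.
by have := y0 a b; rewrite mxE.
Qed.

(** With u = axis_mx^T z, the matrix 1 + u performs the translation because [y] vanishes in the
    columns of [tau]; as [z] does too, u^2 = 0 and the inverse is 1 - u. The hypothesis on [z] says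
    that u preserves each coordinate span. *)
Lemma meets_translate (q : 'I_d -> pred 'I_n) y z :
    tau_free tau y -> tau_free tau z ->
    (forall t k, q t (row_of k) -> ~~ q t (col_of k) -> z k = 0) ->
  meets q (rspan (axis_mx K tau + mx_of y + mx_of z)) =
  meets q (rspan (axis_mx K tau + mx_of y)).
Proof.
move=> y0 z0 zq; pose u := (axis_mx K tau)^T *m mx_of z.
have uu : u *m u = 0.
  by rewrite /u mulmxA -[_ *m mx_of z *m _]mulmxA tau_free_trmx // mulmx0 mul0mx.
have -> : axis_mx K tau + mx_of y + mx_of z = (axis_mx K tau + mx_of y) *m (1%:M + u).
  rewrite mulmxDr mulmx1; congr (_ + _).
  by rewrite /u mulmxA mulmxDl axis_trmx tau_free_trmx // addr0 mul1mx.
apply: meets_stable => [|t i j qi qj].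
  suff /mulmx1_unit[] : (1%:M + u) *m (1%:M - u) = 1%:M by [].
  by rewrite mulmxDl mul1mx mulmxBr mulmx1 uu subr0 subrK.
rewrite !mxE (_ : i == j = false) ?add0r; last first.
  by apply: contraNF qj => /eqP <-.
rewrite big1 // => a _; rewrite !mxE; case: eqP => [ia|]; last by rewrite mul0r.
by rewrite mul1r (zq t) // enum_rankK /= -?ia.
Qed.

(** The scaling is realised by the diagonal matrix with 1 in the columns of [tau] and [s] elsewhere,
    which preserves all coordinate spans. *)
Lemma chart_cond_scale (q : 'I_d -> pred 'I_n) s y : s != 0 ->
  chart_cond q y -> chart_cond q (fun k => s * y k).
Proof.
move=> s0 [y0 yq]; split=> [t b|].
  by have := y0 t b; rewrite !mxE => ->; rewrite mulr0.
pose dg := \row_(j < n) (if j \in codom (pos tau) then 1 else s).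
have dg0 j : dg 0 j != 0 by rewrite mxE; case: ifP; rewrite ?oner_eq0.
have e : (axis_mx K tau + mx_of (fun k => s * y k)) =
    (axis_mx K tau + mx_of y) *m diag_mx dg.
  apply/matrixP => t j; rewrite mul_mx_diag !mxE.
  case: ifPn => [/codomP[b ->]|jt].
    have := y0 t b; rewrite mxE => ->; rewrite mulr0 mulr1 //.
  by rewrite (_ : j == pos tau t = false) ?add0r 1?mulrC //;
    apply: contraNF jt => /eqP ->; exact: codom_f.
rewrite e meets_stable // => [|t i j qi qj].
  by rewrite unitmxE det_diag unitfE; apply/prodf_neq0.
by rewrite !mxE; case: eqP qi => // ->; rewrite (negbTE qj).
Qed.

Lemma coord_ptE : val P = rspan (axis_mx K tau).
Proof.
have [p0 c0] := coord_pt_chart K tau; rewrite -(rspan_coords p0) c0.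
by congr rspan; apply/matrixP => t j; rewrite !mxE addr0.
Qed.

Lemma coord_pt_meets_dim q :
  (#|[set t | q (pos tau t)]| <= \dim (coord_space K tau :&: axes_span K q))%N.
Proof.
pose T := [tuple std K (pos tau t) | t < d].
have freeT : free T by rewrite /free (eqP (coord_space_dim K tau)) size_tuple.
pose s := [seq v <- T | v \in axes_span K q].
have fs : free s by apply: filter_free.
have -> : #|[set t | q (pos tau t)]| = size s.
  rewrite -sum1_card size_filter -sum1_count big_map val_ord_tuple big_enum_cond.
  apply: eq_bigl => t; rewrite inE; apply/idP/memv_axes_span => [qt j qj|std0].
    by rewrite mxE eqxx /=; case: eqP => // jt; rewrite jt qt in qj.
  apply: contraT => /std0/eqP; rewrite mxE !eqxx oner_eq0 //.
rewrite -(eqP (fs : \dim <<s>> == size s)) dimvS // subv_cap; apply/andP; split.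
  by apply: sub_span => v; rewrite mem_filter => /andP[].
by apply/span_subvP => v; rewrite mem_filter => /andP[].
Qed.

Lemma coord_pt_meets (q : 'I_d -> pred 'I_n) :
    (forall t : 'I_d, (t.+1 <= #|[set s | q t (pos tau s)]|)%N) ->
  meets q (coord_space K tau).
Proof.
by move=> qt; apply/forallP => t; apply: leq_trans (qt t) _; exact: coord_pt_meets_dim.
Qed.

Lemma chart_cond0 (q : 'I_d -> pred 'I_n) :
    (forall t : 'I_d, (t.+1 <= #|[set s | q t (pos tau s)]|)%N) ->
  chart_cond q (fun => 0).
Proof.
move=> qt; split=> [t b|]; first by rewrite mxE.
rewrite (_ : mx_of _ = 0) ?addr0; last by apply/matrixP => t j; rewrite !mxE.
by rewrite -coord_ptE; exact: coord_pt_meets.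
Qed.

Lemma chart_cond_cone (q : 'I_d -> pred 'I_n) :
    (forall t : 'I_d, (t.+1 <= #|[set s | q t (pos tau s)]|)%N) ->
  cone (chart_cond q).
Proof.
move=> /chart_cond0 q0; split=> // s y yq; have [->|s0] := eqVneq s 0.
  by rewrite (_ : (fun _ => _) = fun => 0) //; apply/funext => k; rewrite mul0r.
exact: chart_cond_scale.
Qed.

Lemma coneI (Y Y' : set ('I_N -> K)) : cone Y -> cone Y' -> cone (Y `&` Y').
Proof. by move=> [Y0 Ys] [Y0' Ys']; split=> // s y [yY yY']; split; [apply: Ys|apply: Ys']. Qed.

Lemma chart_imageE (X : {pred grass K d n}) (C : {vspace 'rV[K]_n} -> bool) :
    (forall U, U \in X = C (val U)) ->
  chart_image tau X =
  [set y | tau_free tau y /\ C (rspan (axis_mx K tau + mx_of y))]%classic.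
Proof.
move=> XC; apply/seteqP; split=> y /= => [[U [UX pU <-]]|[y0 yC]].
  split; first exact: tau_free_coords.
  by rewrite rspan_coords // -XC.
have [U UE] := chart_pt y0; exists U; have [pU cU] := chart_pt_coords y0 UE.
by rewrite XC UE.
Qed.

Lemma pos_mono (i : idx d n) (s t : 'I_d) : (s <= t)%N -> (pos i s <= pos i t)%N.
Proof.
have iS : sorted (fun a b : 'I_n => (a <= b)%N) (val i).
  apply: sub_sorted (valP i) => a b; exact: ltnW.
move=> st; rewrite /pos !(tnth_nth (pos i s)).
apply: (sorted_leq_nth _ _ _ iS) => //; rewrite ?inE ?size_tuple //.
by move=> a b c; apply: leq_trans.
Qed.

Definition tau_col : pred 'I_N := fun k => col_of k \in codom (pos tau).

Lemma tau_freeP y : tau_free tau y <-> forall k, tau_col k -> y k = 0.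
Proof.
split=> [y0 k /codomP[b kb]|y0 t b].
  by have := y0 (enum_val k).1 b; rewrite mxE -kb -surjective_pairing enum_valK.
by rewrite mxE y0 // /tau_col enum_rankK /= codom_f.
Qed.

Lemma tau_free_cut Q y : tau_free tau y -> tau_free tau (cut Q y).
Proof. by move=> /tau_freeP y0; apply/tau_freeP => k /y0; rewrite /cut => ->; rewrite if_same. Qed.

Lemma tau_free_split Q y :
  tau_free tau (cut Q y) -> tau_free tau (cut (predC Q) y) -> tau_free tau y.
Proof.
move=> /tau_freeP y1 /tau_freeP y2; apply/tau_freeP => k kt.
by have := y1 k kt; have := y2 k kt; rewrite /cut /=; case: (Q k).
Qed.

Lemma chart_cond_cut (q : 'I_d -> pred 'I_n) (Q : pred 'I_N) y :
    (forall t k, q t (row_of k) -> ~~ q t (col_of k) -> ~~ Q k) ->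
  tau_free tau y -> chart_cond q y <-> chart_cond q (cut (predC Q) y).
Proof.
move=> qQ y0; have [yp ym] := (tau_free_cut Q y0, tau_free_cut (predC Q) y0).
have yE : axis_mx K tau + mx_of y =
    axis_mx K tau + mx_of (cut (predC Q) y) + mx_of (cut Q y).
  rewrite -addrA; congr (_ + _); apply/matrixP => t j; rewrite !mxE /cut /=.
  by case: (Q _); rewrite ?addr0 ?add0r.
have zq t k : q t (row_of k) -> ~~ q t (col_of k) -> cut Q y k = 0.
  by move=> qr qc; rewrite /cut (negbTE (qQ t k qr qc)).
by rewrite /chart_cond /= yE (meets_translate ym yp zq); split=> -[].
Qed.

Definition lower (i : 'I_d -> nat) : 'I_d -> pred 'I_n := fun t j => (j.+1 <= i t)%N.
Definition upper (i : 'I_d -> nat) : 'I_d -> pred 'I_n := fun t j => (i t <= j.+1)%N.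

(* Translations along these coordinates preserve the standard flag, those    *)
(* along the other ones preserve the opposite flag.                           *)
Definition up_dir : pred 'I_N := fun k => (col_of k < row_of k)%N.

(** * Decomposition of the chart into slices *)

Section Slices.
Variables (a b : 'I_d -> nat).
Local Notation Yw := (chart_cond (lower a)).
Local Notation Yv := (chart_cond (upper b)).

Lemma chart_cond_lower y : tau_free tau y -> Yw y <-> Yw (cut (predC up_dir) y).
Proof.
apply: chart_cond_cut => t k; rewrite /lower /up_dir -!leqNgt => ra ac.
by apply: ltnW; apply: leq_trans ra _.
Qed.

Lemma chart_cond_upper y : tau_free tau y -> Yv y <-> Yv (cut up_dir y).
Proof.
move=> y0; have -> : cut up_dir y = cut (predC (predC up_dir)) y.
  by apply/funext => k; rewrite /cut /= negbK.
apply: chart_cond_cut y0 => t k; rewrite /upper /up_dir /= negbK -ltnNge => br.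
by move=> /leq_trans/(_ br).
Qed.

Let Zw : set ('I_N -> K) := (Yw `&` coord_subspace (predC up_dir))%classic.
Let Zv : set ('I_N -> K) := (Yv `&` coord_subspace up_dir)%classic.
(** The linear factors omit the columns of [tau], whose coordinates are identically 0 on the
    chart. *)
Let Vw : set ('I_N -> K) := coord_subspace [predI up_dir & predC tau_col].
Let Vv : set ('I_N -> K) := coord_subspace [predI predC up_dir & predC tau_col].

Lemma cutK Q y : cut Q (cut Q y) = cut Q y.
Proof. by apply/funext => k; rewrite /cut; case: (Q k). Qed.

Lemma coord_subspace_tau_free Q y :
  coord_subspace [predI Q & predC tau_col] y <-> cut Q y = y /\ tau_free tau y.
Proof.
rewrite /coord_subspace /= !cut_idP tau_freeP; split=> [y0|[yQ yt] k].
  by split=> k Qk; apply: y0; rewrite /= negb_and ?negbK ?Qk ?orbT.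
by rewrite /= negb_and negbK => /orP[/yQ|/yt].
Qed.

(** The numbers [e] and [f] are those of the slices [Zw] and [Zv]. They pass unchanged to [Yw] and
    [Yv], where the complementary factor is linear, and multiply on the intersection, which is [Zv]
    times [Zw]. *)
Theorem has_mult_slices : (forall t : 'I_d, (t.+1 <= #|[set s | lower a t (pos tau s)]|)%N) ->
    (forall t : 'I_d, (t.+1 <= #|[set s | upper b t (pos tau s)]|)%N) ->
  exists e f, [/\ has_mult Yw e, has_mult Yv f & has_mult (Yw `&` Yv)%classic (e * f)].
Proof.
move=> /chart_cond0 Yw0 /chart_cond0 Yv0.
have cut0 Q : cut Q (fun => 0) = (fun => 0) :> ('I_N -> K).
  by apply/funext => k; rewrite /cut if_same.
have [e Zwe] : exists e, has_mult Zw e by apply: has_mult_exists; split=> //; exact: cut0.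
have [f Zvf] : exists f, has_mult Zv f by apply: has_mult_exists; split=> //; exact: cut0.
have ZwP y : Zw y -> cut (predC up_dir) y = y by case.
have ZvP y : Zv y -> cut up_dir y = y by case.
have VwP y : Vw y -> cut up_dir y = y by case/coord_subspace_tau_free.
have VvP y : Vv y -> cut (predC up_dir) y = y by case/coord_subspace_tau_free.
have ZwE y : tau_free tau y -> Zw (cut (predC up_dir) y) <-> Yw y.
  move=> y0; rewrite (chart_cond_lower y0); split=> [[] //|yw].
  by split=> //; exact: cutK.
have ZvE y : tau_free tau y -> Zv (cut up_dir y) <-> Yv y.
  move=> y0; rewrite (chart_cond_upper y0); split=> [[] //|yv].
  by split=> //; exact: cutK.
exists e, f; split.
- rewrite -[e]mul1r.
  apply: (has_mult_product VwP ZwP _ (has_mult_coord_subspace K _) Zwe).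
  move=> y; split=> [yw|[/coord_subspace_tau_free[_ y1] y2]].
    have [y0 _] := yw; split; last by apply/ZwE.
    by apply/coord_subspace_tau_free; split; [exact: cutK|exact: tau_free_cut].
  have y0 : tau_free tau y by apply: tau_free_split y1 _; case: y2 => -[].
  exact/ZwE.
- rewrite -[f]mulr1.
  apply: (has_mult_product ZvP VvP _ Zvf (has_mult_coord_subspace K _)).
  move=> y; split=> [yv|[y1 /coord_subspace_tau_free[_ y2]]].
    have [y0 _] := yv; split; first by apply/ZvE.
    by apply/coord_subspace_tau_free; split; [exact: cutK|exact: tau_free_cut].
  have y0 : tau_free tau y by apply: tau_free_split _ y2; case: y1 => -[].
  exact/ZvE.
- rewrite mulrC; apply: has_mult_product ZvP ZwP _ Zvf Zwe => y.
  split=> [[yw yv]|[y1 y2]].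
    by have [y0 _] := yw; split; [apply/ZvE|apply/ZwE].
  have y0 : tau_free tau y by case: y1 y2 => [[y1 _] _] [[y2 _] _]; apply: tau_free_split y1 y2.
  by split; [apply/ZwE|apply/ZvE].
Qed.

End Slices.

Lemma card_lower (w : idx d n) (t : 'I_d) : idx_le tau w ->
  (t.+1 <= #|[set s | lower (entry w) t (pos tau s)]|)%N.
Proof.
move=> /forallP tw; pose F := @widen_ord t.+1 d (ltn_ord t).
have F_inj : injective F by move=> i j /(congr1 val) /= /val_inj.
rewrite -[t.+1]card_ord -(card_imset _ F_inj); apply: subset_leq_card.
apply/fintype.subsetP => _ /imsetP[i _ ->]; rewrite inE /lower.
by apply: leq_trans (tw t); rewrite ltnS; apply: pos_mono; exact: (ltn_ord i).
Qed.

(** As entries lie between 1 and n, the nested subtractions evaluate to [entry v (rev_ord t)]; the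
    last t + 1 entries of [tau] reach this bound. *)
Lemma card_upper (v : idx d n) (t : 'I_d) : idx_le v tau ->
  (t.+1 <= #|[set s | upper (fun t => n - (n - entry v (rev_ord t) + 1) + 1)%N t (pos tau s)]|)%N.
Proof.
move=> /forallP tv; pose F i := rev_ord (@widen_ord t.+1 d (ltn_ord t) i).
have F_inj : injective F by move=> i j /rev_ord_inj/(congr1 val) /= /val_inj.
rewrite -[t.+1]card_ord -(card_imset _ F_inj); apply: subset_leq_card.
apply/fintype.subsetP => _ /imsetP[i _ ->]; rewrite inE /upper.
have : (pos tau (rev_ord t) <= pos tau (F i))%N.
  by apply: pos_mono => /=; have := ltn_ord i; have := ltn_ord t; lia.
have := tv (rev_ord t); rewrite /entry; have := ltn_ord (pos v (rev_ord t)); lia.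
Qed.

End SchubertConditions.

Theorem theorem7p6p4 (K : closedFieldType) (d n : nat)
    (hd : (1 <= d)%N) (hdn : (d < n)%N) (w tau v : idx d n)
    (htw : idx_le tau w) (hvt : idx_le v tau) :
  mult_at (richardson (K := K) w v) (coord_pt K tau) =
  mult_at (schubert (K := K) w) (coord_pt K tau) *
  mult_at (opp_schubert (K := K) v) (coord_pt K tau).
Proof.
(* The subtractions in [b] stay unsimplified, so that [opp_schubert v] is [meets (upper b)] by
   conversion. *)
pose a := entry w; pose b := fun t => (n - (n - entry v (rev_ord t) + 1) + 1)%N.
have a_card t := card_lower t htw; have b_card t := card_upper t hvt.
have [e [f [Ye Yf Yef]]] := has_mult_slices K a_card b_card.
have SE : chart_image tau (schubert (K := K) w) = chart_cond tau (lower a).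
  by rewrite (@chart_imageE K d n tau _ (meets (lower a))).
have OE : chart_image tau (opp_schubert (K := K) v) = chart_cond tau (upper b).
  by rewrite (@chart_imageE K d n tau _ (meets (upper b))).
have RE : chart_image tau (richardson (K := K) w v) =
    (chart_cond tau (lower a) `&` chart_cond tau (upper b))%classic.
  rewrite (@chart_imageE K d n tau _ (fun V => meets (lower a) V && meets (upper b) V)) //.
  by apply/seteqP; split=> y /= [] => [y0 /andP[]|[y0 ya] [_ yb]]; split=> //; apply/andP.
have Sc := chart_cond_cone K a_card; have Oc := chart_cond_cone K b_card.
have PS : coord_pt K tau \in schubert (K := K) w := coord_pt_meets K a_card.
have PO : coord_pt K tau \in opp_schubert (K := K) v := coord_pt_meets K b_card.
have -> : mult_at (schubert (K := K) w) (coord_pt K tau) = e.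
  by apply: mult_at_chart; rewrite ?SE.
have -> : mult_at (opp_schubert (K := K) v) (coord_pt K tau) = f.
  by apply: mult_at_chart; rewrite ?OE.
apply: mult_at_chart; rewrite ?RE //; first by apply/andP.
exact: coneI.
Qed.
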